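(* Let $\mathcal{G}$ and $\mathcal{H}$ be topological groupoids with a common unit space $\mathcal{U}$, equipped with action and restriction maps satisfying (ZS1)--(ZS9), and suppose that the Zappa-Szép product groupoid $\mathcal{G}\Join\mathcal{H}$, with the relative product topology from $\mathcal{G}\times\mathcal{H}$, is a locally compact Hausdorff étale groupoid. Then the maps $i : C_c(\mathcal{G}) \to C^*(\mathcal{G}\Join \mathcal{H})$ and $j : C_c(\mathcal{H}) \to C^*(\mathcal{G}\Join \mathcal{H})$ given by $$i(\xi)(g,h) = \delta_{h,t(g)}\,\xi(g)\quad\text{and}\quad j(\eta)(g,h) = \delta_{g,l(h)}\,\eta(h)$$ (Kronecker deltas) extend to $*$-homomorphisms $i:C^*(\mathcal{G})\to C^*(\mathcal{G}\Join \mathcal{H})$ and $j:C^*(\mathcal{H})\to C^*(\mathcal{G}\Join \mathcal{H})$, and the quintuple $(C^*(\mathcal{G}),C^*(\mathcal{H}), i,j, C^*(\mathcal{G}\Join \mathcal{H}))$ is a $C^*$-blend.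
   Context: **Groupoids.** A groupoid is a set with partially defined associative multiplication (on a set of composable pairs) and inversion, with range map $g\mapsto gg^{-1}$ and source map $g\mapsto g^{-1}g$ onto the set of units. A topological groupoid is a groupoid with a topology for which multiplication (on composable pairs with the relative product topology) and inversion are continuous; it is étale if its range map is a local homeomorphism onto its unit space. **Zappa-Szép products.** Let $\mathcal{G},\mathcal{H}$ be groupoids with unit spaces identified by a bijection (a homeomorphism in the topological setting) with a common set $\mathcal{U}$. For $g\in\mathcal{G}$ write $b(g)=gg^{-1}$, $t(g)=g^{-1}g$; for $h\in\mathcal{H}$ write $l(h)=hh^{-1}$, $r(h)=h^{-1}h$. An action map and a restriction map are maps, defined on $\{(h,g)\in\mathcal{H}\times\mathcal{G}: r(h)=b(g)\}$, $(h,g)\mapsto h\cdot g\in\mathcal{G}$ and $(h,g)\mapsto h|_g\in\mathcal{H}$. The axioms, required whenever the formulae make sense, are: (ZS1) $(h_1h_2)\cdot g = h_1\cdot(h_2\cdot g)$; (ZS2) $h\cdot(g_1g_2) = (h\cdot g_1)(h|_{g_1} \cdot g_2)$; (ZS3) $h|_{g_1g_2} = (h|_{g_1})|_{g_2}$; (ZS4) $(h_1h_2)|_g = (h_1|_{h_2\cdot g})(h_2|_{g})$; (ZS5) $b(h\cdot g) = l(h)$; (ZS6) $r(h|_g) = t(g)$; (ZS7) $t(h\cdot g) = l(h|_g)$; (ZS8) $b(g)\cdot g = g$; (ZS9) $h|_{r(h)} = h$. The Zappa-Szép product is $\mathcal{G}\Join\mathcal{H}=\{(g,h)\in\mathcal{G}\times\mathcal{H}: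 t(g)=l(h)\}$, where $(g_1,h_1),(g_2,h_2)$ are composable iff $r(h_1)=b(g_2)$, with product $(g_1,h_1)(g_2,h_2)=(g_1(h_1\cdot g_2),\,h_1|_{g_2}h_2)$ and inverse $(g,h)^{-1}=(h^{-1}\cdot g^{-1},\,h^{-1}|_{g^{-1}})$; it is a groupoid with unit space $\{(u,u):u\in\mathcal{U}\}\cong\mathcal{U}$. (If $\mathcal{G}\Join\mathcal{H}$ is étale in the relative product topology then so are $\mathcal{G}$ and $\mathcal{H}$.) **Groupoid $C^*$-algebras.** For a locally compact Hausdorff étale groupoid $\mathcal{K}$ with range $r$ and source $s$, $C_c(\mathcal{K})$ is a $*$-algebra under $\xi*\eta(g)=\sum_{g_1g_2=g}\xi(g_1)\eta(g_2)$ and $\xi^*(g)=\overline{\xi(g^{-1})}$. Put $\|\xi\|_I=\sup_{u\in\mathcal{K}^{(0)}}\max\{\sum_{r(g)=u}|\xi(g)|,\sum_{s(g)=u}|\xi(g)|\}$. The full groupoid $C^*$-algebra $C^*(\mathcal{K})$ is the completion of $C_c(\mathcal{K})$ in the norm $\|\xi\|=\sup\{\|\pi(\xi)\|:\pi \text{ a } \|\cdot\|_I\text{-bounded } *\text{-representation of } C_c(\mathcal{K})\}$. **$C^*$-blends (Exel).** Given $C^*$-algebras $A,B,X$ and $*$-homomorphisms $i:A\to M(X)$, $j:B\to M(X)$ into the multiplier algebra, let $i\circledast j:A\otimes_{\mathbb{C}}B\to M(X)$ be the linear map on the algebraic tensor product with $a\otimes b\mapsto i(a)j(b)$. The quintuple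 $(A,B,i,j,X)$ is a $C^*$-blend if the range of $i\circledast j$ is contained and dense in $X$. Here $X$ is regarded as a subalgebra of $M(X)$. *)

(* Defs.v *)
From HB Require Import structures.
From mathcomp Require Import all_boot all_order all_algebra.
From mathcomp Require Import sesquilinear complex.
From mathcomp Require Import all_classical all_reals all_analysis.

Set Implicit Arguments.
Unset Strict Implicit.
Unset Printing Implicit Defensive.

Import Order.TTheory GRing.Theory Num.Theory.
Import numFieldNormedType.Exports.

Local Open Scope classical_set_scope.
Local Open Scope ring_scope.

(* The multiplication is a total function; its values outside [gcomp], the    *)
(* set of composable pairs, are irrelevant.                                   *)
Record groupoid (T : Type) := Groupoid {
  gcomp : set (T * T) ;
  gmul : T -> T -> T ;
  ginv : T -> T ;
  ginvK : involutive ginv ;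
  gcompA : forall x y z, gcomp (x, y) -> gcomp (y, z) ->
    gcomp (gmul x y, z) /\ gcomp (x, gmul y z) ;
  gmulA : forall x y z, gcomp (x, y) -> gcomp (y, z) ->
    gmul (gmul x y) z = gmul x (gmul y z) ;
  gcompVg : forall x, gcomp (ginv x, x) ;
  gmulKg : forall x y, gcomp (x, y) -> gmul (ginv x) (gmul x y) = y ;
  gmulgK : forall x y, gcomp (x, y) -> gmul (gmul x y) (ginv y) = x
}.

Section GroupoidTheory.
Variables (T : Type) (G : groupoid T).

Definition grange (x : T) : T := gmul G x (ginv G x).
Definition gsource (x : T) : T := gmul G (ginv G x) x.
Definition gunits : set T := range grange.

Lemma gcompgV x : gcomp G (x, ginv G x).
Proof. by rewrite -{1}(ginvK G x); apply: gcompVg. Qed.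

Lemma grangeV x : grange (ginv G x) = gsource x.
Proof. by rewrite /grange /gsource ginvK. Qed.

Lemma gsourceV x : gsource (ginv G x) = grange x.
Proof. by rewrite /grange /gsource ginvK. Qed.

Lemma grange_unit x : gunits (grange x).
Proof. by exists x. Qed.

Lemma gsource_unit x : gunits (gsource x).
Proof. by exists (ginv G x) => //; rewrite grangeV. Qed.

Lemma gmulgs x : gmul G x (gsource x) = x.
Proof.
rewrite /gsource -(gmulA (gcompgV x) (gcompVg G x)).
by have := gmulgK (gcompgV x); rewrite ginvK.
Qed.

Lemma gmulrg x : gmul G (grange x) x = x.
Proof. by rewrite /grange (gmulA (gcompgV x) (gcompVg G x)) gmulgs. Qed.

Lemma gcompgs x : gcomp G (x, gsource x).
Proof. exact: (gcompA (gcompgV x) (gcompVg G x)).2. Qed.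

Lemma gcomprg x : gcomp G (grange x, x).
Proof. exact: (gcompA (gcompgV x) (gcompVg G x)).1. Qed.

Lemma gcomp_eq x y : gcomp G (x, y) -> gsource x = grange y.
Proof.
move=> cxy; have [cxy' _] := gcompA cxy (gcompgV y).
have [_ cxy''] := gcompA (gcompVg G x) cxy.
have := gmulA cxy'' cxy'.
rewrite (gmulKg cxy) (gmulgK cxy) => e.
by rewrite /gsource /grange e.
Qed.

Lemma eq_gcomp x y : gsource x = grange y -> gcomp G (x, y).
Proof.
move=> e; have c1 := gcompgs x; rewrite e in c1.
by have := (gcompA c1 (gcomprg y)).2; rewrite gmulrg.
Qed.

Lemma grangeM x y : gcomp G (x, y) -> grange (gmul G x y) = grange x.
Proof.
move=> cxy; have [_ /gcomp_eq <-] := gcompA (gcomprg x) cxy.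
exact: gcomp_eq (gcomprg x).
Qed.

Lemma gsourceM x y : gcomp G (x, y) -> gsource (gmul G x y) = gsource y.
Proof.
move=> cxy; have [/gcomp_eq -> _] := gcompA cxy (gcompgs y).
by rewrite -(gcomp_eq (gcompgs y)).
Qed.

Lemma gunitP u : gunits u -> grange u = u /\ gsource u = u.
Proof.
case=> x _ <-; split; first exact: grangeM (gcompgV x).
exact: (etrans (gsourceM (gcompgV x)) (gsourceV x)).
Qed.

Lemma gidem_unit x : gcomp G (x, x) -> gmul G x x = x -> x = grange x.
Proof. by move=> c e; rewrite /grange -{2}e (gmulgK c). Qed.

End GroupoidTheory.

Record unit_identification (T : Type) (G : groupoid T) (U : Type) :=
  UnitIdentification {
  unit_of : U -> T ;
  base_of : T -> U ;
  unit_of_unit : forall u, gunits G (unit_of u) ;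
  unit_ofK : cancel unit_of base_of ;
  base_ofK : forall x, gunits G x -> unit_of (base_of x) = x
}.

Section UnitIdentification.
Variables (T : Type) (G : groupoid T) (U : Type) (e : unit_identification G U).

Definition rng (x : T) : U := base_of e (grange G x).
Definition src (x : T) : U := base_of e (gsource G x).

Lemma unit_rng x : unit_of e (rng x) = grange G x.
Proof. exact/base_ofK/grange_unit. Qed.

Lemma unit_src x : unit_of e (src x) = gsource G x.
Proof. exact/base_ofK/gsource_unit. Qed.

Lemma rng_unit u : rng (unit_of e u) = u.
Proof. by rewrite /rng (gunitP (unit_of_unit e u)).1 unit_ofK. Qed.

Lemma src_unit u : src (unit_of e u) = u.
Proof. by rewrite /src (gunitP (unit_of_unit e u)).2 unit_ofK. Qed.

Lemma gcompP x y : gcomp G (x, y) <-> src x = rng y.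
Proof.
split=> [c|E]; first by rewrite /src (gcomp_eq c).
by apply: eq_gcomp; rewrite -unit_src E unit_rng.
Qed.

Lemma rngM x y : src x = rng y -> rng (gmul G x y) = rng x.
Proof. by move=> /gcompP c; rewrite /rng grangeM. Qed.

Lemma srcM x y : src x = rng y -> src (gmul G x y) = src y.
Proof. by move=> /gcompP c; rewrite /src gsourceM. Qed.

Lemma rngV x : rng (ginv G x) = src x.
Proof. by rewrite /rng grangeV. Qed.

Lemma srcV x : src (ginv G x) = rng x.
Proof. by rewrite /src gsourceV. Qed.

Lemma mul_rng x : gmul G (unit_of e (rng x)) x = x.
Proof. by rewrite unit_rng gmulrg. Qed.

Lemma mul_src x : gmul G x (unit_of e (src x)) = x.
Proof. by rewrite unit_src gmulgs. Qed.

Lemma unitM u : gmul G (unit_of e u) (unit_of e u) = unit_of e u.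
Proof. by have := mul_src (unit_of e u); rewrite src_unit. Qed.

Lemma idem_unit x : src x = rng x -> gmul G x x = x -> x = unit_of e (rng x).
Proof. by move=> /gcompP c /(gidem_unit c); rewrite unit_rng. Qed.

End UnitIdentification.

(* The maps [zact] and [zres] are relevant only on the pairs [(h, g)] with    *)
(* [src eH h = rng eG g].                                                     *)
Record zappa_szep (S T U : Type) (G : groupoid S) (H : groupoid T)
    (eG : unit_identification G U) (eH : unit_identification H U) :=
  ZappaSzep {
  zact : T -> S -> S ;
  zres : T -> S -> T ;
  ZS1 : forall h1 h2 g, gcomp H (h1, h2) -> src eH h2 = rng eG g ->
    zact (gmul H h1 h2) g = zact h1 (zact h2 g) ;
  ZS2 : forall h g1 g2, gcomp G (g1, g2) -> src eH h = rng eG g1 ->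
    zact h (gmul G g1 g2) = gmul G (zact h g1) (zact (zres h g1) g2) ;
  ZS3 : forall h g1 g2, gcomp G (g1, g2) -> src eH h = rng eG g1 ->
    zres h (gmul G g1 g2) = zres (zres h g1) g2 ;
  ZS4 : forall h1 h2 g, gcomp H (h1, h2) -> src eH h2 = rng eG g ->
    zres (gmul H h1 h2) g = gmul H (zres h1 (zact h2 g)) (zres h2 g) ;
  ZS5 : forall h g, src eH h = rng eG g -> rng eG (zact h g) = rng eH h ;
  ZS6 : forall h g, src eH h = rng eG g -> src eH (zres h g) = src eG g ;
  ZS7 : forall h g, src eH h = rng eG g ->
    src eG (zact h g) = rng eH (zres h g) ;
  ZS8 : forall g, zact (unit_of eH (rng eG g)) g = g ;
  ZS9 : forall h, zres h (unit_of eG (src eH h)) = h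
}.

Section ZappaSzepProduct.
Variables (S T : choiceType) (U : Type) (G : groupoid S) (H : groupoid T).
Variables (eG : unit_identification G U) (eH : unit_identification H U).
Variable Z : zappa_szep eG eH.

Definition zs_set : set (S * T) := [set p | src eG p.1 = rng eH p.2].

(* With [S] and [T] topological, [zs_set] seen as a type carries the relative *)
(* product topology.                                                          *)
Definition zs_type : Type := zs_set.

Definition zs_comp : set (zs_type * zs_type) :=
  [set z | src eH (val z.1).2 = rng eG (val z.2).1].

Definition zs_mul_raw (p q : S * T) : S * T :=
  (gmul G p.1 (zact Z p.2 q.1), gmul H (zres Z p.2 q.1) q.2).

Definition zs_inv_raw (p : S * T) : S * T :=
  (zact Z (ginv H p.2) (ginv G p.1), zres Z (ginv H p.2) (ginv G p.1)).

Definition zs_mul (z w : zs_type) : zs_type :=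
  insubd z (zs_mul_raw (val z) (val w)).

Definition zs_inv (z : zs_type) : zs_type := insubd z (zs_inv_raw (val z)).

Lemma zs_typeP (z : zs_type) : src eG (val z).1 = rng eH (val z).2.
Proof. exact: (set_mem (valP z)). Qed.

Lemma zs_mulE z w : zs_comp (z, w) ->
  val (zs_mul z w) = zs_mul_raw (val z) (val w).
Proof.
rewrite /zs_comp /= => c.
suff P : zs_set (zs_mul_raw (val z) (val w)) by rewrite val_insubd (mem_set P).
rewrite /zs_set /=.
have E : src eG (val z).1 = rng eG (zact Z (val z).2 (val w).1).
  by rewrite (ZS5 Z c) zs_typeP.
rewrite (srcM E) (ZS7 Z c) rngM// (ZS6 Z c); exact: zs_typeP.
Qed.

Lemma zs_inv_comp (z : zs_type) :
  src eH (ginv H (val z).2) = rng eG (ginv G (val z).1).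
Proof. by rewrite srcV rngV zs_typeP. Qed.

Lemma zs_invE z : val (zs_inv z) = zs_inv_raw (val z).
Proof.
have P : zs_set (zs_inv_raw (val z)) by apply: (ZS7 Z); apply: zs_inv_comp.
by rewrite val_insubd (mem_set P).
Qed.

Local Notation B z := (rng eG (val (z : zs_type)).1).
Local Notation D z := (src eH (val (z : zs_type)).2).

Lemma zs_rngM z w : zs_comp (z, w) -> B (zs_mul z w) = B z.
Proof.
by move=> c; rewrite (zs_mulE c) /= rngM// (ZS5 Z c) zs_typeP.
Qed.

Lemma zs_srcM z w : zs_comp (z, w) -> D (zs_mul z w) = D w.
Proof.
by move=> c; rewrite (zs_mulE c) /= srcM// (ZS6 Z c) zs_typeP.
Qed.

Lemma zs_rngV z : B (zs_inv z) = D z.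
Proof. by rewrite zs_invE /= (ZS5 Z (zs_inv_comp z)) rngV. Qed.

Lemma zs_srcV z : D (zs_inv z) = B z.
Proof. by rewrite zs_invE /= (ZS6 Z (zs_inv_comp z)) srcV. Qed.

Lemma zact_unit h : zact Z h (unit_of eG (src eH h)) = unit_of eG (rng eH h).
Proof.
have c : src eH h = rng eG (unit_of eG (src eH h)) by rewrite rng_unit.
have cu : src eG (unit_of eG (src eH h)) = rng eG (unit_of eG (src eH h)).
  by rewrite rng_unit src_unit.
rewrite -(ZS5 Z c); apply: idem_unit.
  by rewrite (ZS7 Z c) (ZS5 Z c) ZS9.
have := ZS2 Z (h := h) ((gcompP eG _ _).2 cu) c; rewrite ZS9.
by rewrite unitM.
Qed.

Lemma zres_unit g : zres Z (unit_of eH (rng eG g)) g = unit_of eH (src eG g).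
Proof.
have c : src eH (unit_of eH (rng eG g)) = rng eG g by rewrite src_unit.
have cu : src eH (unit_of eH (rng eG g)) = rng eH (unit_of eH (rng eG g)).
  by rewrite rng_unit src_unit.
have E : src eH (zres Z (unit_of eH (rng eG g)) g) =
         rng eH (zres Z (unit_of eH (rng eG g)) g).
  by rewrite (ZS6 Z c) -(ZS7 Z c) ZS8.
rewrite -(ZS6 Z c) E; apply: idem_unit => //.
have := ZS4 Z (g := g) ((gcompP eH _ _).2 cu) c; rewrite ZS8.
by rewrite unitM.
Qed.

Lemma zs_unit_proof u : (unit_of eG u, unit_of eH u) \in zs_set.
Proof. by rewrite inE /zs_set /= src_unit rng_unit. Qed.

Definition zs_unit (u : U) : zs_type := SigSub (zs_unit_proof u).

Lemma zs_unitE u : val (zs_unit u) = (unit_of eG u, unit_of eH u).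
Proof. by rewrite SubK. Qed.

Lemma zs_mul1 z : zs_mul (zs_unit (B z)) z = z.
Proof.
apply: val_inj; rewrite zs_mulE /zs_comp /= ?src_unit//.
rewrite /zs_mul_raw /= ZS8 zres_unit mul_rng zs_typeP mul_rng.
by rewrite -surjective_pairing.
Qed.

Lemma zs_mulr1 z : zs_mul z (zs_unit (D z)) = z.
Proof.
apply: val_inj; rewrite zs_mulE /zs_comp /= ?rng_unit//.
rewrite /zs_mul_raw /= zact_unit ZS9 -zs_typeP !mul_src.
by rewrite -surjective_pairing.
Qed.

Lemma zs_mulVg z : zs_mul (zs_inv z) z = zs_unit (D z).
Proof.
apply: val_inj; rewrite zs_mulE /zs_comp /= ?zs_srcV//.
have c := zs_inv_comp z; have cV := gcompVg G (val z).1.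
rewrite /zs_mul_raw zs_invE /= -(ZS2 Z cV c) -(ZS3 Z cV c).
rewrite -/(gsource G (val z).1) -(unit_src eG) zs_typeP -srcV ZS9 zact_unit.
by rewrite rngV -/(gsource H (val z).2) -(unit_src eH).
Qed.

Lemma zs_mulgV z : zs_mul z (zs_inv z) = zs_unit (B z).
Proof.
apply: val_inj; rewrite zs_mulE /zs_comp /= ?zs_rngV//.
have c := zs_inv_comp z; have cV := gcompgV H (val z).2.
rewrite /zs_mul_raw zs_invE /= -(ZS1 Z cV c) -(ZS4 Z cV c).
rewrite -/(grange H (val z).2) -(unit_rng eH) -zs_typeP -rngV ZS8 zres_unit.
by rewrite srcV -/(grange G (val z).1) -(unit_rng eG).
Qed.

Lemma zs_compA x y z : zs_comp (x, y) -> zs_comp (y, z) ->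
  zs_comp (zs_mul x y, z) /\ zs_comp (x, zs_mul y z).
Proof.
move=> cxy cyz; rewrite /zs_comp /=; split; first by rewrite zs_srcM.
by rewrite zs_rngM.
Qed.

Lemma zs_mulA x y z : zs_comp (x, y) -> zs_comp (y, z) ->
  zs_mul (zs_mul x y) z = zs_mul x (zs_mul y z).
Proof.
move=> cxy cyz; have [c1 c2] := zs_compA cxy cyz.
apply: val_inj; rewrite (zs_mulE c1) (zs_mulE c2) (zs_mulE cxy) (zs_mulE cyz).
rewrite /zs_mul_raw /=; have xP := zs_typeP x; have yP := zs_typeP y.
rewrite /zs_comp /= in cxy cyz.
have cG : src eG (val y).1 = rng eG (zact Z (val y).2 (val z).1).
  by rewrite (ZS5 Z cyz).
have cH : src eH (zres Z (val x).2 (val y).1) = rng eH (val y).2.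
  by rewrite (ZS6 Z cxy).
have cG' := (gcompP eG _ _).2 cG; have cH' := (gcompP eH _ _).2 cH.
rewrite (ZS2 Z cG' cxy) (ZS3 Z cG' cxy) (ZS1 Z cH' cyz) (ZS4 Z cH' cyz).
have cR : src eH (zres Z (val x).2 (val y).1) =
          rng eG (zact Z (val y).2 (val z).1) by rewrite cH (ZS5 Z cyz).
congr pair.
  apply: gmulA; apply/(gcompP eG); first by rewrite (ZS5 Z cxy).
  by rewrite (ZS7 Z cxy) (ZS5 Z cR).
apply: gmulA; apply/(gcompP eH); first by rewrite (ZS6 Z cR) (ZS7 Z cyz).
by rewrite (ZS6 Z cyz); apply: zs_typeP.
Qed.

Lemma zs_compVg x : zs_comp (zs_inv x, x).
Proof. exact: zs_srcV. Qed.

Lemma zs_mulKg x y : zs_comp (x, y) -> zs_mul (zs_inv x) (zs_mul x y) = y.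
Proof.
move=> c; rewrite -(zs_mulA (zs_compVg x) c) zs_mulVg.
by rewrite (c : D x = B y) zs_mul1.
Qed.

Lemma zs_mulgK x y : zs_comp (x, y) -> zs_mul (zs_mul x y) (zs_inv y) = x.
Proof.
move=> c; rewrite (zs_mulA c); last exact: (esym (zs_rngV y)).
by rewrite zs_mulgV -(c : D x = B y) zs_mulr1.
Qed.

Lemma zs_invK : involutive zs_inv.
Proof.
move=> x; have := zs_mulKg (zs_compVg x).
have -> : zs_mul (zs_inv x) x = zs_unit (D (zs_inv (zs_inv x))).
  by rewrite zs_mulVg zs_srcV zs_rngV.
by rewrite zs_mulr1.
Qed.

Definition zs_groupoid : groupoid zs_type :=
  Groupoid zs_invK zs_compA zs_mulA zs_compVg zs_mulKg zs_mulgK.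

End ZappaSzepProduct.

Section TopologicalGroupoid.
Variables (T : topologicalType) (G : groupoid T).

Definition topological_groupoid : Prop :=
  {within gcomp G, continuous (fun p : T * T => gmul G p.1 p.2)} /\
  continuous (ginv G).

Definition unit_homeomorphism (U : topologicalType)
    (e : unit_identification G U) : Prop :=
  continuous (unit_of e) /\ {within gunits G, continuous (base_of e)}.

Lemma grange_in x : grange G x \in gunits G.
Proof. by rewrite inE; apply: grange_unit. Qed.

Definition range_map (x : T) : gunits G := SigSub (grange_in x).

End TopologicalGroupoid.

Definition local_homeomorphism (S T : topologicalType) (f : S -> T) :=
  forall x, exists2 V : set S, open V /\ V x &
    [/\ open (f @` V), {within V, continuous f} &
        exists2 g : T -> S, {in V, cancel f g} &
          {within f @` V, continuous g}].

Definition lch_etale_groupoid (T : topologicalType) (G : groupoid T) :=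
  [/\ topological_groupoid G, hausdorff_space T, locally_compact [set: T] &
      local_homeomorphism (range_map G)].

Section Norms.
Variable R : realType.

(* The norm of a normed space over [R[i]] takes its values in [R[i]]; these   *)
(* values are real.                                                           *)
Definition rnorm (V : normedModType R[i]) (x : V) : R := complex.Re `|x|.

Definition op_norm (V W : normedModType R[i]) (f : V -> W) : \bar R :=
  ereal_sup [set (rnorm (f x))%:E | x in [set x : V | rnorm x <= 1]].

Definition bounded_operator (V W : normedModType R[i]) (f : V -> W) : Prop :=
  linear f /\ exists c : R[i], forall x, `|f x| <= c * `|x|.

End Norms.

HB.mixin Record Lmodule_isStarAlgebra (R : realType) A
    & GRing.Lmodule R[i] A := {
  smul : A -> A -> A ;
  star : A -> A ;
  smulA : associative smul ;
  smulDl : left_distributive smul +%R ;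
  smulDr : right_distributive smul +%R ;
  smulZl : forall (c : R[i]) x y, smul (c *: x) y = c *: smul x y ;
  smulZr : forall (c : R[i]) x y, smul x (c *: y) = c *: smul x y ;
  starK : involutive star ;
  starD : {morph star : x y / x + y} ;
  starZ : forall (c : R[i]) x, star (c *: x) = conjc c *: star x ;
  starM : forall x y, star (smul x y) = smul (star y) (star x)
}.

(* Complex *-algebras, not necessarily unital.                                *)
#[short(type="starAlgType")]
HB.structure Definition StarAlgebra (R : realType) :=
  {A of Lmodule_isStarAlgebra R A & GRing.Lmodule R[i] A}.

HB.mixin Record NormedStarAlgebra_isCstar (R : realType) A
    & StarAlgebra R A & CompleteNormedModule R[i] A := {
  cnormM : forall x y : A, `|smul x y| <= `|x| * `|y| ;
  cstar_norm : forall x : A, `|smul (star x) x| = `|x| ^+ 2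
}.

#[short(type="cstarAlgType")]
HB.structure Definition CstarAlgebra (R : realType) :=
  {A of NormedStarAlgebra_isCstar R A & StarAlgebra R A
      & CompleteNormedModule R[i] A}.

Section StarHomomorphism.
Variables (R : realType) (A B : starAlgType R).

Definition star_homomorphism (f : A -> B) : Prop :=
  [/\ linear f, {morph f : x y / smul x y} & {morph f : x / star x}].

End StarHomomorphism.

Section Multipliers.
Variables (R : realType) (X : cstarAlgType R).
Implicit Types (p q : (X -> X) * (X -> X)) (x y : X).

Definition double_centralizer p : Prop :=
  [/\ bounded_operator p.1, bounded_operator p.2,
      forall x y, p.1 (smul x y) = smul (p.1 x) y,
      forall x y, p.2 (smul x y) = smul x (p.2 y) &
      forall x y, smul x (p.1 y) = smul (p.2 x) y].

Definition multiplier_pred : {pred (X -> X) * (X -> X)} :=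
  fun p => `[< double_centralizer p >].

(* The multiplier algebra M(X).                                               *)
Definition multiplier : Type := {p | p \in multiplier_pred}.

HB.instance Definition _ := SubType.on multiplier.
HB.instance Definition _ := [Choice of multiplier by <:].

Lemma star_norm x : `|star x| = `|x|.
Proof.
have le y : `|y| <= `|star y|.
  have [->|y0] := eqVneq y 0; first by rewrite normr0.
  have ny0 : 0 < `|y| by rewrite normr_gt0.
  by rewrite -(ler_pM2r ny0) -expr2 -cstar_norm cnormM.
by apply/eqP; rewrite eq_le le andbT -{2}(starK x) le.
Qed.

Lemma smul0l x : smul 0 x = 0.
Proof. by have := smulZl 0 0 x; rewrite !scale0r. Qed.

Lemma smul0r x : smul x 0 = 0.
Proof. by have := smulZr 0 x 0; rewrite !scale0r. Qed.

Lemma bounded_operator0 : bounded_operator (0 : X -> X).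
Proof.
split=> [a x y|]; first by rewrite [RHS]addr0 [RHS]scaler0.
by exists 0 => x; rewrite mul0r normr_le0.
Qed.

Lemma bounded_operatorZD (a : R[i]) (f g : X -> X) :
  bounded_operator f -> bounded_operator g -> bounded_operator (a *: f + g).
Proof.
move=> [fl [c fc]] [gl [d gd]]; split=> [b x y|].
  by rewrite !fctE /= fl gl !scalerDr !scalerA [b * a]mulrC addrACA.
exists (`|a| * c + d) => x; rewrite !fctE (le_trans (ler_normD _ _))// mulrDl.
by rewrite lerD// normrZ -mulrA ler_wpM2l.
Qed.

Lemma bounded_operator_comp (f g : X -> X) :
  bounded_operator f -> bounded_operator g -> bounded_operator (f \o g).
Proof.
move=> [fl [c fc]] [gl [d gd]]; split=> [b x y|]; first by rewrite /= gl fl.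
exists (`|c| * d) => x; rewrite /= (le_trans (fc _))//.
have cg0 : 0 <= c * `|g x| by exact: le_trans (fc (g x)).
by rewrite -(ger0_norm cg0) normrM normr_id -mulrA ler_wpM2l.
Qed.

Definition conj_map (f : X -> X) : X -> X := fun x => star (f (star x)).

Lemma bounded_operator_conj (f : X -> X) :
  bounded_operator f -> bounded_operator (conj_map f).
Proof.
move=> [fl [c fc]]; split=> [b x y|].
  by rewrite /conj_map starD starZ fl starD starZ conjcK.
by exists c => x; rewrite /conj_map star_norm (le_trans (fc _))// star_norm.
Qed.

Lemma multiplier_submod : submod_closed multiplier_pred.
Proof.
split=> [|a p q].
  apply/asboolP; split=> //= [||x y|x y|x y]; do ?exact: bounded_operator0;
  by rewrite ?smul0l ?smul0r.
move=> /asboolP[p1 p2 pl pr plr] /asboolP[q1 q2 ql qr qlr]; apply/asboolP.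
split=> [||x y|x y|x y] /=; do ?exact: bounded_operatorZD; rewrite !fctE.
- by rewrite pl ql smulDl smulZl.
- by rewrite pr qr smulDr smulZr.
- by rewrite smulDl smulDr smulZl smulZr plr qlr.
Qed.

HB.instance Definition _ :=
  GRing.isSubmodClosed.Build R[i] _ multiplier_pred multiplier_submod.
HB.instance Definition _ := [SubChoice_isSubLmodule of multiplier by <:].

Lemma multiplierP (m : multiplier) : double_centralizer (val m).
Proof. exact/asboolP/(valP m). Qed.

Lemma mult_mul_proof (m n : multiplier) :
  ((val m).1 \o (val n).1, (val n).2 \o (val m).2) \in multiplier_pred.
Proof.
have [m1 m2 ml mr mlr] := multiplierP m.
have [n1 n2 nl nr nlr] := multiplierP n.
apply/asboolP; split=> [||x y|x y|x y] /=; do ?exact: bounded_operator_comp.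
- by rewrite nl ml.
- by rewrite mr nr.
- by rewrite mlr nlr.
Qed.

Definition mult_mul (m n : multiplier) : multiplier :=
  SigSub (mult_mul_proof m n).

Lemma mult_star_proof (m : multiplier) :
  (conj_map (val m).2, conj_map (val m).1) \in multiplier_pred.
Proof.
have [m1 m2 ml mr mlr] := multiplierP m.
apply/asboolP; split=> [||x y|x y|x y] /=; do ?exact: bounded_operator_conj.
- by rewrite /conj_map starM mr starM starK.
- by rewrite /conj_map starM ml starM starK.
- by apply: (can_inj (@starK _ X)); rewrite /conj_map !starM !starK mlr.
Qed.

Definition mult_star (m : multiplier) : multiplier :=
  SigSub (mult_star_proof m).

Lemma multiplier_eq (m n : multiplier) :
  (val m).1 =1 (val n).1 -> (val m).2 =1 (val n).2 -> m = n.
Proof.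
move=> e1 e2; apply: val_inj.
by rewrite [LHS]surjective_pairing (funext e1) (funext e2) -surjective_pairing.
Qed.

Lemma mult_mulA : associative mult_mul.
Proof. by move=> m n k; apply: multiplier_eq. Qed.

Lemma mult_mulDl : left_distributive mult_mul +%R.
Proof.
move=> m n k; apply: multiplier_eq => x //=.
have [[kl _] _ _ _ _] := multiplierP k; have [_ [kr _] _ _ _] := multiplierP k.
by have := kr 1 ((val m).2 x) ((val n).2 x); rewrite !scale1r.
Qed.

Lemma mult_mulDr : right_distributive mult_mul +%R.
Proof.
move=> m n k; apply: multiplier_eq => x //=.
have [[ml _] _ _ _ _] := multiplierP m.
by have := ml 1 ((val n).1 x) ((val k).1 x); rewrite !scale1r.
Qed.

Lemma mult_linear0 (f : X -> X) : bounded_operator f -> f 0 = 0.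
Proof.
move=> [fl _]; have := fl 1 0 0; rewrite !scale1r addr0 => e.
by apply: (addrI (f 0)); rewrite addr0 -e.
Qed.

Lemma mult_linearZ (f : X -> X) (c : R[i]) x :
  bounded_operator f -> f (c *: x) = c *: f x.
Proof.
move=> fb; have := fb.1 c x 0; by rewrite (mult_linear0 fb) !addr0.
Qed.

Lemma mult_mulZl (c : R[i]) m n : mult_mul (c *: m) n = c *: mult_mul m n.
Proof.
apply: multiplier_eq => x //=.
by have [_ b _ _ _] := multiplierP n; apply: (mult_linearZ c _ b).
Qed.

Lemma mult_mulZr (c : R[i]) m n : mult_mul m (c *: n) = c *: mult_mul m n.
Proof.
apply: multiplier_eq => x //=.
by have [b _ _ _ _] := multiplierP m; apply: (mult_linearZ c _ b).
Qed.

Lemma mult_starK : involutive mult_star.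
Proof. by move=> m; apply: multiplier_eq => x /=; rewrite /conj_map !starK. Qed.

Lemma mult_starD : {morph mult_star : m n / m + n}.
Proof. by move=> m n; apply: multiplier_eq => x; exact: starD. Qed.

Lemma mult_starZ (c : R[i]) m : mult_star (c *: m) = conjc c *: mult_star m.
Proof. by apply: multiplier_eq => x; exact: starZ. Qed.

Lemma mult_starM m n :
  mult_star (mult_mul m n) = mult_mul (mult_star n) (mult_star m).
Proof. by apply: multiplier_eq => x /=; rewrite /conj_map /= starK. Qed.

HB.instance Definition _ := Lmodule_isStarAlgebra.Build R multiplier
  mult_mulA mult_mulDl mult_mulDr mult_mulZl mult_mulZr
  mult_starK mult_starD mult_starZ mult_starM.

Lemma mult_of_proof x : (smul x, smul^~ x) \in multiplier_pred.
Proof.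
apply/asboolP; split=> [||y z|y z|y z] /=; rewrite ?smulA//.
  split=> [a y z|]; first by rewrite smulDr smulZr.
  by exists `|x| => y; apply: cnormM.
split=> [a y z|]; first by rewrite smulDl smulZl.
by exists `|x| => y; rewrite mulrC cnormM.
Qed.

(* The canonical inclusion of X into M(X).                                    *)
Definition mult_of x : multiplier := SigSub (mult_of_proof x).

End Multipliers.

Section CstarBlend.
Variables (R : realType) (A B X : cstarAlgType R).
Variables (i : A -> multiplier X) (j : B -> multiplier X).

(* The linear map on the algebraic tensor product of A and B that sends each  *)
(* elementary tensor (a, b) to i(a)j(b), evaluated at the formal sum [t] of   *)
(* elementary tensors.  Every tensor is represented by such a formal sum, so  *)
(* letting [t] vary gives the range of the map.                               *)
Definition blend_map (t : seq (A * B)) : multiplier X :=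
  \sum_(p <- t) smul (i p.1) (j p.2).

Definition cstar_blend : Prop :=
  [/\ star_homomorphism i, star_homomorphism j,
      forall t, exists x, blend_map t = mult_of x &
      dense [set x : X | exists t, blend_map t = mult_of x]].

End CstarBlend.

Record hilbertSpace (R : realType) := HilbertSpace {
  hilbert_sort :> completeNormedModType R[i] ;
  inner : {dot hilbert_sort for @conjc R} ;
  innerE : forall x, inner x x = `|x| ^+ 2
}.

Section GroupoidCstar.
Variables (R : realType) (T : topologicalType) (K : groupoid T).
Implicit Types xi eta : T -> R[i].

Definition Cc : set (T -> R[i]) :=
  [set xi | continuous (xi : T -> R[i]^o) /\
            compact (closure [set g | xi g != 0])].

(* The sum ranges over a set of pairs on which the summand has finite support *)
(* when K is etale and xi and eta are in [Cc].                                *)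
Definition convolution xi eta : T -> R[i] := fun g =>
  \sum_(p \in [set p | gcomp K p /\ gmul K p.1 p.2 = g]) (xi p.1 * eta p.2).

Definition involution xi : T -> R[i] := fun g => conjc (xi (ginv K g)).

Definition I_norm xi : \bar R :=
  ereal_sup [set maxe
    (\esum_(g in [set g | grange K g = u]) (complex.Re `|xi g|)%:E)
    (\esum_(g in [set g | gsource K g = u]) (complex.Re `|xi g|)%:E)
    | u in gunits K].

(* Only the values of [pi] on [Cc] are relevant.                              *)
Record star_representation (V : hilbertSpace R) (pi : (T -> R[i]) -> V -> V) :
    Prop := StarRepresentation {
  rep_bounded : forall xi, Cc xi -> bounded_operator (pi xi) ;
  rep_linear : forall (a : R[i]) xi eta, Cc xi -> Cc eta -> forall v,
    pi (fun g => a * xi g + eta g) v = a *: pi xi v + pi eta v ;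
  rep_convolution : forall xi eta, Cc xi -> Cc eta -> forall v,
    pi (convolution xi eta) v = pi xi (pi eta v) ;
  rep_involution : forall xi, Cc xi -> forall v w,
    inner V (pi xi v) w = inner V v (pi (involution xi) w)
}.

Definition I_bounded (V : hilbertSpace R) (pi : (T -> R[i]) -> V -> V) :=
  exists2 C : R, 0 <= C &
    forall xi, Cc xi -> (op_norm (pi xi) <= C%:E * I_norm xi)%E.

Definition full_norm xi : \bar R :=
  ereal_sup [set r | exists (V : hilbertSpace R) (pi : (T -> R[i]) -> V -> V),
    [/\ star_representation pi, I_bounded pi & r = op_norm (pi xi)]].

(* The full C*-algebra of K: a C*-algebra together with a *-homomorphism from *)
(* [Cc] onto a dense *-subalgebra that is isometric for [full_norm], that is, *)
(* a completion of [Cc]; it is unique up to a unique isomorphism.             *)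
Record groupoid_cstar := GroupoidCstar {
  cstar_sort :> cstarAlgType R ;
  Cc_in : (T -> R[i]) -> cstar_sort ;
  Cc_in_linear : forall (a : R[i]) xi eta, Cc xi -> Cc eta ->
    Cc_in (fun g => a * xi g + eta g) = a *: Cc_in xi + Cc_in eta ;
  Cc_in_convolution : forall xi eta, Cc xi -> Cc eta ->
    Cc_in (convolution xi eta) = smul (Cc_in xi) (Cc_in eta) ;
  Cc_in_involution : forall xi, Cc xi ->
    Cc_in (involution xi) = star (Cc_in xi) ;
  Cc_in_norm : forall xi, Cc xi -> (rnorm (Cc_in xi))%:E = full_norm xi ;
  Cc_in_dense : dense [set Cc_in xi | xi in Cc]
}.

End GroupoidCstar.

Arguments Cc R T : clear implicits.

Section ZappaSzepMaps.
Variables (R : realType) (S T : choiceType) (U : Type).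
Variables (G : groupoid S) (H : groupoid T).
Variables (eG : unit_identification G U) (eH : unit_identification H U).

Definition zs_i (xi : S -> R[i]) (z : zs_type eG eH) : R[i] :=
  ((val z).2 == unit_of eH (src eG (val z).1))%:R * xi (val z).1.

Definition zs_j (eta : T -> R[i]) (z : zs_type eG eH) : R[i] :=
  ((val z).1 == unit_of eG (rng eH (val z).2))%:R * eta (val z).2.

End ZappaSzepMaps.

(* Main.v *)
Require Import Defs.
From HB Require Import structures.
From mathcomp Require Import all_boot all_order all_algebra.
From mathcomp Require Import sesquilinear complex.
From mathcomp Require Import all_classical all_reals all_analysis.

Set Implicit Arguments.
Unset Strict Implicit.
Unset Printing Implicit Defensive.

Import Order.TTheory GRing.Theory Num.Theory.
Import numFieldNormedType.Exports.

Local Open Scope classical_set_scope.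
Local Open Scope ring_scope.

(** Write K for the Zappa-Szep product groupoid.  Both G and H sit in K, through
    g |-> (g, t(g)) and h |-> (l(h), h), as subgroupoids that contain every unit
    of K.  They are open: (g, h) lies in the copy of G exactly when (l(h), h) is
    a unit of K, and the units of an etale groupoid form an open set; the copy
    of H is handled symmetrically.  They are also closed, being the equalizers
    of a continuous retraction and the identity in a Hausdorff space.  Hence G
    and H inherit from K the properties on which the argument rests: they are
    Hausdorff, and around each point there is a compactly supported bump
    function inside an open set on which the range map has a continuous local
    section.  The maps i and j are extension by zero along these embeddings
    ([zs_iE], [zs_jE]).

    Extension by zero along a wide open embedding L -> K preserves C_c,
    convolution and involution, and does not increase the I-norm.  Composing
    with it turns an I-bounded representation of C_c(K) into one of C_c(L), so
    it is contractive for the full norms ([full_norm_extend0]) and extends by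
    continuity to a *-homomorphism of the completions ([cstar_extend0]).  For
    multiplicativity of the extension, C_c(L) has to be closed under products.
    Convolution with a function supported where the range map has a section is
    a one-term sum, so the product is in C_c ([Cc_convolution]); a quadratic
    partition of unity splits every element of C_c(L) into a finite sum of such
    functions ([section_bump_split]).

    For the blend, every (g, h) in K factors uniquely as (g, t(g)) (l(h), h), so
    i(xi) * j(eta) is the function (g, h) |-> xi(g) eta(h)
    ([convolution_zs_i_zs_j]).  These functions span C_c(K) exactly, without any
    approximation ([Cc_tensor_span]).  Indeed let e be a bump function on H
    supported in a set where the range map l has a section s.  For zeta in
    C_c(K) and (g, h) in K with e(h) <> 0, the point h is s(t(g)), hence a
    function of g; so zeta(g, h) |e(h)|^2 w(h) is the product of
    zeta(g, s(t(g))) e(s(t(g))) w(s(t(g))) by the conjugate of e(h).  Summing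
    over finitely many bumps e_k, with w the inverse of the sum of the |e_k|^2,
    recovers zeta.  Density of C_c(K) in its completion concludes. *)
(** * Topological preliminaries *)

Lemma closed_equalizer (X Y : topologicalType) (u v : X -> Y) :
  hausdorff_space Y -> continuous u -> continuous v ->
  closed [set x | u x = v x].
Proof.
move=> hY cu cv; rewrite -openC openE => x /= /eqP; rewrite /interior.
move: hY; rewrite open_hausdorff => /[apply].
move=> -[[A B]]/=; rewrite !inE => -[Ax Bx] [oA oB AB].
have : nbhs x (u @^-1` A `&` v @^-1` B).
  by apply: filterI; [apply: cu|apply: cv]; exact: open_nbhs_nbhs.
apply: filterS => y [/= Ay By] e.
by have : set0 (v y); [rewrite -AB; split=> //; rewrite -e|].
Qed.

Lemma hausdorff_inj (X Y : topologicalType) (f : X -> Y) :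
  continuous f -> injective f -> hausdorff_space Y -> hausdorff_space X.
Proof.
move=> cf fi; rewrite !open_hausdorff => hY x y /eqP xy.
have /hY[[A B]] : f x != f y by apply/eqP => /fi.
rewrite /= !inE => -[Ax By] [oA oB AB].
exists (f @^-1` A, f @^-1` B) => /=; first by rewrite !inE.
split; [by apply: open_comp|by apply: open_comp|].
by rewrite -preimage_setI AB preimage_set0.
Qed.

Lemma cvg_within_map (X Y : topologicalType) (f : X -> Y) (x : X) (P : set X)
    (Q : set Y) : {for x, continuous f} -> (forall t, P t -> Q (f t)) ->
  f @ within P (nbhs x) --> within Q (nbhs (f x)).
Proof.
move=> cf PQ N nN; have cn : nbhs x [set t | Q (f t) -> N (f t)] := cf _ nN.
change (nbhs x [set t | P t -> N (f t)]).
by apply: filterS cn => t /= + /PQ; apply.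
Qed.

Lemma cvg_into_within (X Y : topologicalType) (f : X -> Y) (x : X) (Q : set Y) :
  {for x, continuous f} -> (forall t, Q (f t)) ->
  f @ x --> within Q (nbhs (f x)).
Proof.
move=> cf fQ; have := @cvg_within_map _ _ f x setT Q cf (fun t _ => fQ t).
by rewrite withinET.
Qed.

(** Local sections are used as total maps on the ambient space, with filters
    restricted to the units; this transfers neighborhoods from the unit space
    seen as a type to that setting. *)
Lemma nbhs_set_type (X : topologicalType) (A : set X) (a : A) (P : set A) :
  nbhs a P -> within A (nbhs (val a)) [set u | forall b : A, val b = u -> P b].
Proof.
move=> [_ [[W oW <-] Wa WP]].
have nW : nbhs (val a) W by apply: open_nbhs_nbhs; split.
by apply: filterS nW => u Wu Au b bu; apply: WP; rewrite /= -bu in Wu *.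
Qed.

(** The principle by which identities are extended from a dense set. *)
Lemma dense_closed_all (X : topologicalType) (D P : set X) :
  dense D -> closed P -> D `<=` P -> forall x, P x.
Proof.
move=> dD cP DP x; rewrite (closure_id P).1// => N Nx.
have [|d [/interior_subset Nd Dd]] := dD _ _ (open_interior N).
  by exists x.
by exists d; split=> //; exact: DP.
Qed.

(** * Compactly supported continuous functions *)

(** Stated over an abstract field so that unification never has to unfold the
    structure of the complex numbers. *)
Section ContinuousScalar.
Variables (K : numFieldType) (X : topologicalType).
Implicit Types f g : X -> K^o.

Lemma continuousM_at f g x : {for x, continuous f} -> {for x, continuous g} ->
  {for x, continuous (fun x => f x * g x : K^o)}.
Proof. by move=> cf cg; exact: cvgM. Qed.

Lemma continuousV_at f x : f x != 0 -> {for x, continuous f} ->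
  {for x, continuous (fun x => (f x)^-1 : K^o)}.
Proof. by move=> f0 cf; exact: cvgV. Qed.

Lemma continuousD_at f g x : {for x, continuous f} -> {for x, continuous g} ->
  {for x, continuous (fun x => f x + g x : K^o)}.
Proof. by move=> cf cg; exact: cvgD. Qed.

Lemma continuous_at_dist f x : {for x, continuous f} <->
  forall e, 0 < e -> \forall t \near x, `|f x - f t| < e.
Proof. exact: cvgrPdist_lt. Qed.

End ContinuousScalar.

Section CompactSupport.
Variables (R : realType).

Definition supp (X : topologicalType) (f : X -> R[i]) : set X :=
  closure [set x | f x != 0].

Lemma supp_closed (X : topologicalType) (f : X -> R[i]) : closed (supp f).
Proof. exact: closed_closure. Qed.

Lemma supp_out (X : topologicalType) (f : X -> R[i]) x : ~ supp f x -> f x = 0.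
Proof.
by move=> nx; apply/eqP/negPn/negP => fx; apply: nx; exact: subset_closure.
Qed.

Lemma sub_supp (X : topologicalType) (f : X -> R[i]) (C : set X) :
  closed C -> (forall x, ~ C x -> f x = 0) -> supp f `<=` C.
Proof.
move=> cC fC; rewrite [X in _ `<=` X](closure_id _).1//.
apply: closureS => x /= fx; apply: contrapT => /fC e.
by rewrite e eqxx in fx.
Qed.

(** In a Hausdorff space compact sets are closed, so any compact set outside of
    which the function vanishes bounds its support. *)
Lemma Cc_sub (X : topologicalType) (f : X -> R[i]) (C : set X) :
  hausdorff_space X -> continuous (f : X -> R[i]^o) -> compact C ->
  (forall x, ~ C x -> f x = 0) -> Cc R X f.
Proof.
move=> hX cf cC fC; split=> //; apply: (subclosed_compact _ cC).
  exact: supp_closed.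
by apply: sub_supp => //; exact: compact_closed.
Qed.

Lemma continuous_compact_support (X : topologicalType) (f : X -> R[i]^o)
    (C : set X) :
  closed C -> (forall x, ~ C x -> f x = 0) ->
  (forall x, C x -> {for x, continuous f}) -> continuous f.
Proof.
move=> cC f0 fC x; have [/fC//|Cx] := pselect (C x).
have nx : nbhs x (~` C) by apply: open_nbhs_nbhs; split=> //; rewrite openC.
apply: cvg_near_cst.
by near do rewrite (f0 x Cx) f0//; exact: nx.
Unshelve. all: by end_near. Qed.

Lemma norm_conjc (z : R[i]) : `|conjc z| = `|z|.
Proof. exact: (norm_conjC z). Qed.

Lemma continuous_conjc : continuous (fun z : R[i]^o => conjc z : R[i]^o).
Proof.
move=> z; apply/continuous_at_dist => e e0.
have : {for z, continuous (id : R[i]^o -> R[i]^o)} by exact: cvg_id.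
move=> /continuous_at_dist /(_ e e0); apply: filterS => t /=.
by rewrite -rmorphB norm_conjc.
Qed.

Lemma Cc_linear (X : topologicalType) (a : R[i]) (f g : X -> R[i]) :
  Cc R X f -> Cc R X g -> Cc R X (fun x => a * f x + g x).
Proof.
move=> [cf sf] [cg sg]; split.
  move=> x; apply: (@continuousD_at _ _ (fun x => a * f x) g); last exact: cg.
  by apply: (@continuousM_at _ _ (fun=> a) f); [exact: cvg_cst|exact: cf].
have sC : compact (supp f `|` supp g) by exact: compactU.
apply: (subclosed_compact _ sC); first exact: supp_closed.
apply: sub_supp; first by apply: closedU; exact: supp_closed.
by move=> x /not_orP[/supp_out -> /supp_out ->]; rewrite mulr0 addr0.
Qed.

Lemma Cc0 (T : topologicalType) : Cc R T (fun=> 0).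
Proof.
split; first by move=> x; exact: cvg_cst.
suff -> : [set x : T | (0 : R[i]) != 0] = set0.
  by rewrite closure0; exact: compact0.
by apply/seteqP; split=> x //=; rewrite eqxx.
Qed.

Lemma CcD (X : topologicalType) (f g : X -> R[i]) :
  Cc R X f -> Cc R X g -> Cc R X (fun x => f x + g x).
Proof.
move=> cf cg; have := Cc_linear 1 cf cg.
by congr Cc; apply/funext => x; rewrite mul1r.
Qed.

End CompactSupport.

(** * Extension of *-homomorphisms from a dense subset *)

Lemma dense_approx (K : numFieldType) (A : normedModType K) (D : set A) (a : A)
    (e : K) :
  dense D -> 0 < e -> exists2 d, D d & `|a - d| < e.
Proof.
move=> dD e0; have [||d []] := dD (ball_ Num.norm a e).
- by exists a; rewrite /ball_ /= subrr normr0.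
- have := ball_open_nbhs a e0; rewrite -ball_normE => -[].
  by [].
by rewrite /ball_ /= => ade Dd; exists d.
Qed.

(** The map to extend is given by its graph [Gam], which is how it arises later:
    two points of C_c may have the same image in the completion.  The value at
    [a] is the limit of the second components of the points of [Gam] whose first
    component tends to [a]; contractivity makes this filter Cauchy. *)
Lemma contractive_extension (K : numFieldType) (A : normedModType K)
    (B : completeNormedModType K) (Gam : set (A * B)) :
  dense (fst @` Gam) ->
  (forall p q, Gam p -> Gam q -> `|p.2 - q.2| <= `|p.1 - q.1|) ->
  exists h : A -> B, (forall p, Gam p -> h p.1 = p.2) /\
    forall a b, `|h a - h b| <= `|a - b|.
Proof.
move=> dG lG.
pose F (a : A) : set_system B := filter_from [set e : K | 0 < e]
  (fun e => snd @` [set p | Gam p /\ `|a - p.1| < e]).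
have near1 a e : 0 < e -> exists2 p, Gam p & `|a - p.1| < e.
  by move=> /(dense_approx a dG)[_ [p Gp <-]]; exists p.
have FF a : ProperFilter (F a).
  apply: filter_from_proper; last first.
    move=> e /= /(near1 a)[p Gp ap].
    by exists p.2, p.
  apply: filter_from_filter; first by exists 1 => /=.
  move=> d e /= d0 e0; exists (Num.min d e).
    by rewrite /= comparable_lt_min ?d0 ?e0 ?real_comparable ?gtr0_real.
  move=> _ [p [Gp ape] <-]; move: ape.
  rewrite comparable_lt_min ?real_comparable ?gtr0_real// => /andP[apd ape].
  by split; exists p.
have cF a : cvg (F a).
  apply/cauchy_cvgP/cauchy_exP => e /= e0.
  have e20 : 0 < e / 2 by rewrite divr_gt0.
  have [p Gp ap] := near1 a _ e20.
  exists p.2; exists (e / 2) => // _ [q [Gq aq] <-].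
  rewrite -ball_normE /= (le_lt_trans (lG _ _ Gp Gq))//.
  rewrite -(subrKA a) [ltRHS](splitr e) (le_lt_trans (ler_normD _ _))//.
  by rewrite ltrD// distrC.
have lF a p : Gam p -> `|lim (F a) - p.2| <= `|a - p.1|.
  move=> Gp; apply/ler_addgt0Pr => e e0.
  have e20 : 0 < e / 2 by rewrite divr_gt0.
  have : \forall b \near F a, `|lim (F a) - b| < e / 2.
    exact: (@cvgr_dist_lt _ _ _ _ _ id _ (cF a)).
  have : F a (snd @` [set p | Gam p /\ `|a - p.1| < e / 2]) by exists (e / 2).
  move=> /filterI/[apply]/filter_ex[_ [[q [Gq aq] <-] bq]].
  rewrite -(subrKA q.2) (le_trans (ler_normD _ _))//.
  rewrite [leRHS](_ : _ = e / 2 + (`|a - p.1| + e / 2)); last first.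
    by rewrite addrCA -splitr.
  rewrite lerD//; first exact: ltW.
  rewrite (le_trans (lG _ _ Gq Gp))// -(subrKA a) (le_trans (ler_normD _ _))//.
  by rewrite addrC lerD// distrC ltW.
exists (fun a => lim (F a)); split=> [p Gp|a b].
  have := lF p.1 _ Gp; rewrite subrr normr0 normr_le0 subr_eq0.
  by move/eqP.
apply/ler_addgt0Pr => e e0.
have e20 : 0 < e / 2 by rewrite divr_gt0.
have [p Gp bp] := near1 b _ e20.
rewrite -(subrKA p.2) (le_trans (ler_normD _ _))//.
rewrite [leRHS](_ : _ = (`|a - b| + e / 2) + e / 2); last first.
  by rewrite -addrA -splitr.
rewrite lerD//; last first.
  by rewrite distrC (le_trans (lF _ _ Gp))// ltW.
rewrite (le_trans (lF _ _ Gp))// -(subrKA b) (le_trans (ler_normD _ _))//.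
by rewrite lerD// ltW.
Qed.

Lemma lipschitz_continuous (K : numFieldType) (V W : normedModType K)
    (f : V -> W) (c : K) :
  0 < c -> (forall x y, `|f x - f y| <= c * `|x - y|) -> continuous f.
Proof.
move=> c0 fc x; apply/cvgrPdist_lt => e e0.
have : \forall t \near x, `|x - t| < e / c.
  by apply: (@cvgr_dist_lt _ _ _ _ _ id); [exact: cvg_id|rewrite divr_gt0].
apply: filterS => t xt; rewrite (le_lt_trans (fc _ _))//.
by rewrite mulrC -ltr_pdivlMr.
Qed.

Section CstarContinuity.
Variables (R : realType) (X : cstarAlgType R).
Implicit Types x y z : X.

Lemma smulBl x y z : smul (x - y) z = smul x z - smul y z.
Proof. by rewrite smulDl -(scaleN1r y) smulZl scaleN1r. Qed.

Lemma smulBr x y z : smul x (y - z) = smul x y - smul x z.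
Proof. by rewrite smulDr -(scaleN1r z) smulZr scaleN1r. Qed.

Lemma starB x y : star (x - y) = star x - star y.
Proof. by rewrite starD -(scaleN1r y) starZ rmorphN1 scaleN1r. Qed.

Lemma smul_continuousl y : continuous (smul^~ y : X -> X).
Proof.
apply: (@lipschitz_continuous _ _ _ _ (1 + `|y|)).
  by rewrite ltr_pwDl.
move=> x z; rewrite -smulBl (le_trans (cnormM _ _))// mulrC ler_wpM2r//.
by rewrite lerDr.
Qed.

Lemma smul_continuousr y : continuous (smul y : X -> X).
Proof.
apply: (@lipschitz_continuous _ _ _ _ (1 + `|y|)).
  by rewrite ltr_pwDl.
move=> x z; rewrite -smulBr (le_trans (cnormM _ _))// ler_wpM2r//.
by rewrite lerDr.
Qed.

Lemma star_continuous : continuous (@star R X).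
Proof.
apply: (@lipschitz_continuous _ _ _ _ 1) => // x z.
by rewrite -starB star_norm mul1r.
Qed.

End CstarContinuity.

(** Linearity of [Gam] turns the bound on norms into a bound on distances, so
    the previous extension applies; each algebraic identity then holds on the
    dense set and is closed in each variable separately. *)
Lemma star_homomorphism_extension (R : realType) (A B : cstarAlgType R)
    (Gam : set (A * B)) :
  dense (fst @` Gam) ->
  (forall p, Gam p -> `|p.2| <= `|p.1|) ->
  (forall (c : R[i]) p q, Gam p -> Gam q ->
    Gam (c *: p.1 + q.1, c *: p.2 + q.2)) ->
  (forall p q, Gam p -> Gam q -> Gam (smul p.1 q.1, smul p.2 q.2)) ->
  (forall p, Gam p -> Gam (star p.1, star p.2)) ->
  exists h : A -> B, star_homomorphism h /\ forall p, Gam p -> h p.1 = p.2.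
Proof.
move=> dG nG linG mulG starG.
have [|h [hG h1]] := contractive_extension dG.
  move=> p q Gp Gq; have := nG _ (linG (-1) _ _ Gq Gp) => /=.
  by rewrite !scaleN1r ![- _ + _]addrC.
have ch : continuous h.
  by apply: (@lipschitz_continuous _ _ _ _ 1) => // x y; rewrite mul1r.
have ind (u v : A -> B) : continuous u -> continuous v ->
    (forall p, Gam p -> u p.1 = v p.1) -> u =1 v.
  move=> cu cv uv; apply: (dense_closed_all dG).
    by apply: closed_equalizer => //; exact: norm_hausdorff.
  by move=> _ [p Gp <-]; exact: uv.
have cD (X Y : cstarAlgType R) (c : R[i]) (u v : X -> Y) :
    continuous u -> continuous v -> continuous (fun x => c *: u x + v x).
  move=> cu cv x; apply: cvgD; last exact: cv.
  by apply: cvgZl_tmp; exact: cu.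
have cst (X Y : cstarAlgType R) (y : Y) : continuous (fun _ : X => y).
  by move=> x; exact: cvg_cst.
have cid (X : cstarAlgType R) : continuous (fun x : X => x).
  by move=> x; exact: cvg_id.
have cc (X Y W : cstarAlgType R) (u : X -> Y) (v : Y -> W) :
    continuous u -> continuous v -> continuous (fun x => v (u x)).
  by move=> cu cv x; apply: continuous_comp; [exact: cu|exact: cv].
exists h; split=> //; split.
- move=> c a b; move: a.
  apply: (ind (fun a => h (c *: a + b)) (fun a => c *: h a + h b)).
  + by refine (cc _ _ _ _ _ _ ch); apply: cD.
  + exact: cD.
  move=> p Gp; move: b.
  apply: (ind (fun b => h (c *: p.1 + b)) (fun b => c *: h p.1 + h b)).
  + by refine (cc _ _ _ _ _ _ ch); exact: (cD _ _ c (fun=> p.1)).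
  + exact: (cD _ _ c (fun=> h p.1)).
  move=> q Gq; rewrite !hG//; exact: (hG _ (linG c _ _ Gp Gq)).
- move=> a b; move: a.
  apply: (ind (fun a => h (smul a b)) (fun a => smul (h a) (h b))).
  + by refine (cc _ _ _ _ _ _ ch); exact: smul_continuousl.
  + by refine (cc _ _ _ _ _ ch _); exact: smul_continuousl.
  move=> p Gp; move: b.
  apply: (ind (fun b => h (smul p.1 b)) (fun b => smul (h p.1) (h b))).
  + by refine (cc _ _ _ _ _ _ ch); exact: smul_continuousr.
  + by refine (cc _ _ _ _ _ ch _); exact: smul_continuousr.
  move=> q Gq; rewrite !hG//; exact: (hG _ (mulG _ _ Gp Gq)).
- apply: (ind (fun a => h (star a)) (fun a => star (h a))).
  + by refine (cc _ _ _ _ _ _ ch); exact: star_continuous.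
  + by refine (cc _ _ _ _ _ ch _); exact: star_continuous.
  move=> p Gp; rewrite !hG//; exact: (hG _ (starG _ Gp)).
Qed.

Lemma star_homomorphism_comp (R : realType) (A B C : starAlgType R)
    (f : A -> B) (g : B -> C) :
  star_homomorphism f -> star_homomorphism g ->
  star_homomorphism (fun a => g (f a)).
Proof.
move=> [f1 f2 f3] [g1 g2 g3]; split.
- by move=> c x y; rewrite f1 g1.
- by move=> x y; rewrite f2 g2.
- by move=> x; rewrite f3 g3.
Qed.

Lemma star_homomorphism_mult_of (R : realType) (X : cstarAlgType R) :
  star_homomorphism (@mult_of R X).
Proof.
split.
- move=> c x y; apply: multiplier_eq => z /=.
    by rewrite smulDl smulZl.
  by rewrite smulDr smulZr.
- by move=> x y; apply: multiplier_eq => z /=; rewrite smulA.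
- by move=> x; apply: multiplier_eq => z /=; rewrite /conj_map starM starK.
Qed.

(** * Wide open subgroupoids and extension by zero *)

Section Embedding.
Variables (T' T : topologicalType) (L : groupoid T') (K : groupoid T).

(** [L] as a subgroupoid of [K] that contains all units; the continuous left
    inverse [pr] makes [iota] a homeomorphism onto its range. *)
Record wide_open_embedding (iota : T' -> T) (pr : T -> T') : Prop :=
  WideOpenEmbedding {
  emb_cont : continuous iota ;
  pr_cont : continuous pr ;
  embK : cancel iota pr ;
  emb_comp : forall x y, gcomp K (iota x, iota y) <-> gcomp L (x, y) ;
  embM : forall x y, gcomp L (x, y) ->
    iota (gmul L x y) = gmul K (iota x) (iota y) ;
  emb_units : gunits K `<=` range iota ;
  emb_open : open (range iota)
}.

Variables (iota : T' -> T) (pr : T -> T').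
Hypothesis E : wide_open_embedding iota pr.

Lemma emb_inj : injective iota.
Proof. exact: can_inj (embK E). Qed.

Lemma emb_range z : range iota z <-> iota (pr z) = z.
Proof. by split=> [[x _ <-]|<-]; [rewrite (embK E)|exists (pr z)]. Qed.

(** The image of a unit is idempotent, and the only idempotents of a groupoid
    are its units. *)
Lemma emb_grange x : iota (grange L x) = grange K (iota x).
Proof.
have c := gcompgV L x.
have ci : gcomp K (iota x, iota (ginv L x)) by apply/(emb_comp E).
have e : iota (grange L x) = gmul K (iota x) (iota (ginv L x)).
  exact: (embM E c).
have [e1 e2] := gunitP (grange_unit L x).
have cu : gcomp L (grange L x, grange L x) by apply: eq_gcomp; rewrite e1 e2.
have -> : iota (grange L x) = grange K (iota (grange L x)).
  apply: gidem_unit; first by apply/(emb_comp E).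
  by rewrite -(embM E cu) -[X in gmul L X _]e1 gmulrg.
by rewrite e grangeM.
Qed.

Lemma embV x : iota (ginv L x) = ginv K (iota x).
Proof.
have c := gcompgV L x.
have ci : gcomp K (iota x, iota (ginv L x)) by apply/(emb_comp E).
rewrite -(gmulKg ci) -(embM E c) -/(grange L x) emb_grange.
by rewrite -(gsourceV K (iota x)) gmulgs.
Qed.

Lemma emb_gsource x : iota (gsource L x) = gsource K (iota x).
Proof. by rewrite -(grangeV L) emb_grange embV grangeV. Qed.

Lemma emb_unit_ex u : gunits K u -> exists2 v, gunits L v & u = iota v.
Proof.
move=> Ku; have [v _ uv] := emb_units E Ku.
exists (grange L v); first exact: grange_unit.
by rewrite emb_grange uv (gunitP Ku).1.
Qed.

Hypothesis hT : hausdorff_space T.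

(** The range is where the retraction agrees with the identity. *)
Lemma emb_closed : closed (range iota).
Proof.
have -> : range iota = [set z | iota (pr z) = z].
  by apply/seteqP; split=> z /= /emb_range.
apply: closed_equalizer => // z; last exact: cvg_id.
by apply: continuous_comp; [exact: (pr_cont E)|exact: (emb_cont E)].
Qed.

Lemma emb_hausdorff : hausdorff_space T'.
Proof. exact: hausdorff_inj (emb_cont E) emb_inj hT. Qed.

Lemma emb_preimage_compact (C : set T) : compact C -> compact (iota @^-1` C).
Proof.
move=> cC.
have -> : iota @^-1` C = pr @` (C `&` range iota).
  apply/seteqP; split=> [x Cx|_ [z [Cz [x _ xz]] <-]].
    by exists (iota x); [split=> //; exists x|rewrite (embK E)].
  by rewrite -xz in Cz *; rewrite (embK E).
apply: continuous_compact; first exact/continuous_subspaceT/(pr_cont E).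
by apply: compact_closedI => //; exact: emb_closed.
Qed.

Variable R : realType.

Definition extend0 (xi : T' -> R[i]) (z : T) : R[i] :=
  (iota (pr z) == z)%:R * xi (pr z).

Lemma extend0_emb xi x : extend0 xi (iota x) = xi x.
Proof. by rewrite /extend0 (embK E) eqxx mul1r. Qed.

Lemma extend0_out xi z : ~ range iota z -> extend0 xi z = 0.
Proof. by move/emb_range/eqP/negbTE => e; rewrite /extend0 e mul0r. Qed.

(** Continuity at the boundary is automatic since the range is clopen. *)
Lemma Cc_extend0 xi : Cc R T' xi -> Cc R T (extend0 xi).
Proof.
move=> [cx sx]; apply: (@Cc_sub _ _ _ (iota @` supp xi)) => //.
- apply: continuous_compact_support emb_closed (@extend0_out xi) _ => z rz.
  have nz : nbhs z (range iota).
    by apply: open_nbhs_nbhs; split=> //; exact: (emb_open E).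
  have exz : extend0 xi z = xi (pr z).
    by case: rz => x _ <-; rewrite extend0_emb (embK E).
  have : {for z, continuous (xi \o pr : T -> R[i]^o)}.
    by apply: continuous_comp; [exact: (pr_cont E)|exact: cx].
  rewrite /prop_for /continuous_at exz; apply: cvg_trans; apply: near_eq_cvg.
  by apply: filterS nz => _ [x _ <-]; rewrite /= (embK E) extend0_emb.
- by apply: continuous_compact => //; exact/continuous_subspaceT/(emb_cont E).
move=> z nz; have [[x _ ex]|] := pselect (range iota z); last first.
  exact: extend0_out.
rewrite -ex extend0_emb; apply: supp_out => sxx.
by apply: nz; exists x.
Qed.

Lemma extend0_linear (a : R[i]) xi eta :
  extend0 (fun g => a * xi g + eta g) =
  (fun z => a * extend0 xi z + extend0 eta z).
Proof. by apply/funext => z; rewrite /extend0 mulrDr mulrCA. Qed.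

Lemma extend0_involution xi :
  extend0 (involution L xi) = involution K (extend0 xi).
Proof.
apply/funext => z; rewrite /involution.
have [[x _ <-]|nz] := pselect (range iota z).
  by rewrite -embV !extend0_emb.
rewrite !extend0_out ?rmorph0// => -[x _ e].
by apply: nz; exists (ginv L x) => //; rewrite embV e ginvK.
Qed.

(** If the product of two elements lies in the range but one factor does not,
    the term vanishes; the remaining factorizations are the images of the
    factorizations in [L]. *)
Lemma extend0_convolution xi eta :
  convolution K (extend0 xi) (extend0 eta) = extend0 (convolution L xi eta).
Proof.
apply/funext => z; rewrite /convolution.
have [[x _ <-]|nz] := pselect (range iota z); last first.
  rewrite extend0_out// fsbig1// => -[p1 p2] [/= c e].
  have [[x1 _ e1]|n1] := pselect (range iota p1); last first.
    by rewrite (extend0_out _ n1) mul0r.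
  have [[x2 _ e2]|n2] := pselect (range iota p2); last first.
    by rewrite (extend0_out _ n2) mulr0.
  case: nz; rewrite -e -e1 -e2; exists (gmul L x1 x2) => //; apply: (embM E).
  by apply/(emb_comp E); rewrite e1 e2.
rewrite extend0_emb.
pose P := [set p | gcomp L p /\ gmul L p.1 p.2 = x].
pose h (p : T' * T') := (iota p.1, iota p.2).
rewrite -(fsbig_widen (h @` P)); last 2 first.
- move=> _ [[x1 x2] [/= c e] <-]; split; first exact/(emb_comp E).
  by rewrite -(embM E c) e.
- move=> [p1 p2] [[/= c e] nP].
  have [[x1 _ e1]|n1] := pselect (range iota p1); last first.
    by rewrite /= (extend0_out _ n1) mul0r.
  have [[x2 _ e2]|n2] := pselect (range iota p2); last first.
    by rewrite /= (extend0_out _ n2) mulr0.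
  case: nP; exists (x1, x2); last by rewrite /h /= e1 e2.
  move: c e; rewrite -e1 -e2 => /(emb_comp E) c.
  rewrite -(embM E c) => /emb_inj.
  by split.
rewrite fsbig_image; last first.
  by move=> [x1 x2] [y1 y2] _ _ [/emb_inj -> /emb_inj ->].
by apply: eq_fsbigr => p _; rewrite /= !extend0_emb.
Qed.

(** Every unit of [K] is the image of a unit of [L], and over it the function
    lives on the image of the corresponding fiber of [L]. *)
Lemma I_norm_extend0 xi : (I_norm K (extend0 xi) <= I_norm L xi)%E.
Proof.
have key (s : forall X, groupoid X -> X -> X) v :
    (forall x, iota (s _ L x) = s _ K (iota x)) ->
    \esum_(g in [set g | s _ K g = iota v]) (complex.Re `|extend0 xi g|)%:E =
    \esum_(g in [set g | s _ L g = v]) (complex.Re `|xi g|)%:E.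
  move=> hs; rewrite [RHS](_ : _ = \esum_(g in [set g | s _ L g = v])
      (complex.Re `|extend0 xi (iota g)|)%:E); last first.
    by apply: eq_esum => g _; rewrite extend0_emb.
  rewrite -(esum_image _ iota
    (fun g => (complex.Re `|extend0 xi g|)%:E)); last first.
    by move=> x y _ _ /emb_inj.
  rewrite (_ : iota @` [set g | s _ L g = v] =
      [set g | s _ K g = iota v] `&` range iota); last first.
    apply/seteqP; split=> [y [x /= xv <-]|y [/= e [x _ xe]]].
      by rewrite -hs xv; split=> //; exists x.
    by exists x => //=; apply: emb_inj; rewrite hs xe.
  rewrite esum_mkcondr; apply: eq_esum => g _; case: ifPn => //.
  by rewrite notin_setE => /(extend0_out xi) ->; rewrite normr0.
apply: ge_ereal_sup => _ [u Ku <-]; have [v Lv ->] := emb_unit_ex Ku.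
apply: ereal_sup_ubound; exists v => //.
by rewrite (key (@grange) v emb_grange) (key (@gsource) v emb_gsource).
Qed.

(** Every representation that counts for the left-hand side gives, composed
    with extension by zero, one that counts for the right-hand side. *)
Lemma full_norm_extend0 xi :
  (full_norm K (extend0 xi) <= full_norm L xi)%E.
Proof.
apply: ge_ereal_sup => _ [V [pi [rep [C C0 bC] ->]]].
apply: ereal_sup_ubound; exists V, (pi \o extend0); split=> //.
  case: rep => rb rl rc ri; split.
  - by move=> f cf; apply: rb; exact: Cc_extend0.
  - by move=> a f g cf cg v /=; rewrite extend0_linear rl//; exact: Cc_extend0.
  - move=> f g cf cg v /=; rewrite -extend0_convolution rc//; exact: Cc_extend0.
  - by move=> f cf v w /=; rewrite extend0_involution ri//; exact: Cc_extend0.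
exists C => // f cf; apply: (le_trans (bC _ (Cc_extend0 cf))).
by apply: lee_wpmul2l; rewrite ?lee_fin//; exact: I_norm_extend0.
Qed.

End Embedding.

(** * Topological groupoids and local sections of the range map *)

Section TopologicalGroupoidMaps.
Variables (T : topologicalType) (L : groupoid T).
Hypothesis tL : topological_groupoid L.

Lemma continuous_grange : continuous (grange L).
Proof.
have [cm ci] := tL => x; move/subspace_continuousP: cm => cm.
have cp : {for x, continuous (fun t => (t, ginv L t))}.
  by apply: cvg_pair; [exact: cvg_id|exact: ci].
have c1 := cvg_into_within cp (@gcompgV _ L).
exact: (cvg_comp _ _ c1 (cm _ (gcompgV L x))).
Qed.

Lemma continuous_gsource : continuous (gsource L).
Proof.
move=> x; have -> : gsource L = grange L \o ginv L.
  by apply/funext => t; rewrite /= grangeV.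
apply: continuous_comp; [exact: tL.2|exact: continuous_grange].
Qed.

Lemma closed_gcomp : hausdorff_space T -> closed (gcomp L).
Proof.
move=> hT; have -> : gcomp L = [set p | gsource L p.1 = grange L p.2].
  apply/seteqP; split=> -[x y] h; first exact: gcomp_eq.
  exact: eq_gcomp.
apply: closed_equalizer => // p.
  apply: (@continuous_comp _ _ _ fst (gsource L) p); first exact: cvg_fst.
  exact: continuous_gsource.
apply: (@continuous_comp _ _ _ snd (grange L) p); first exact: cvg_snd.
exact: continuous_grange.
Qed.

End TopologicalGroupoidMaps.

Section UnitMaps.
Variables (T U : topologicalType) (L : groupoid T).
Variable e : unit_identification L U.
Hypotheses (tL : topological_groupoid L) (he : unit_homeomorphism e).

Lemma continuous_rng : continuous (rng e).
Proof.
move=> x; have [_ /subspace_continuousP cb] := he.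
have c1 := cvg_into_within (@continuous_grange _ L tL x) (@grange_unit _ L).
exact: (cvg_comp _ _ c1 (cb _ (grange_unit L x))).
Qed.

Lemma continuous_src : continuous (src e).
Proof.
have -> : src e = rng e \o ginv L by apply/funext => x; rewrite /= rngV.
move=> x; apply: continuous_comp; [exact: tL.2|exact: continuous_rng].
Qed.

End UnitMaps.

(** [sg] inverts the range map on [V] and is continuous at the points of
    [range V].  The conditions near [grange L x] express that [range V] is open
    in the unit space.  In this form the notion pulls
    back along embeddings. *)
Definition local_section (T : topologicalType) (L : groupoid T) (V : set T)
    (sg : T -> T) :=
  forall x, V x ->
  [/\ sg (grange L x) = x,
      within (gunits L) (nbhs (grange L x))
        [set u | V (sg u) /\ grange L (sg u) = u] &
      sg @ within (gunits L) (nbhs (grange L x)) --> x].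

Lemma etale_local_section (T : topologicalType) (L : groupoid T) :
  local_homeomorphism (range_map L) ->
  forall x, exists V sg, [/\ open V, V x & local_section L V sg].
Proof.
move=> lh x; have [V [oV Vx] [ofV cf [g gK cg]]] := lh x.
exists V, (g \o insubd (range_map L x)); split=> // y Vy.
have e (b : gunits L) : insubd (range_map L x) (val b) = b by exact: valKd.
have ey : g (range_map L y) = y by rewrite gK// inE.
have fy : (range_map L @` V) (range_map L y) by exists y.
have ny : nbhs (range_map L y) (range_map L @` V).
  by apply: open_nbhs_nbhs; split.
have cgy : {for range_map L y, continuous g}.
  move: cg; rewrite continuous_open_subspace// => /(_ (range_map L y)).
  by apply; rewrite inE.
split.
- by rewrite /= -[grange L y]/(val (range_map L y)) e.
- have := nbhs_set_type ny; rewrite /within /=.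
  apply: filterS => u + Lu => /(_ Lu).
  have ub := mem_set Lu; move=> /(_ (SigSub ub) erefl)[z Vz ze].
  have eu : insubd (range_map L x) u = range_map L z.
    by rewrite ze; exact: (e (SigSub ub)).
  by rewrite /= eu gK ?inE//; split=> //; exact: (congr1 val ze).
- move=> N; rewrite -{1}ey => /cgy /nbhs_set_type; rewrite /within /=.
  apply: filterS => u + Lu => /(_ Lu); have ub := mem_set Lu.
  have eu : insubd (range_map L x) u = SigSub ub by exact: (e (SigSub ub)).
  by move=> /(_ (SigSub ub) erefl); rewrite /= eu.
Qed.

(** Near a unit [u] the range map is injective on some open [V]; if both [x] and
    its range are in [V], they have the same range, so they coincide. *)
Lemma open_gunits (T : topologicalType) (K : groupoid T) :
  topological_groupoid K -> local_homeomorphism (range_map K) ->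
  open (gunits K).
Proof.
move=> tK lh; rewrite openE => u Ku; rewrite /interior.
have [V [sg [oV Vu sec]]] := etale_local_section lh u.
have nV : nbhs u V by apply: open_nbhs_nbhs.
have nrV : nbhs u (grange K @^-1` V).
  by apply: (continuous_grange tK); rewrite (gunitP Ku).1.
apply: filterS2 nV nrV => x Vx Vr.
have [<- _ _] := sec _ Vx; have [e _ _] := sec _ Vr.
by rewrite -(gunitP (grange_unit K x)).1 e; exact: grange_unit.
Qed.

Section FiberSum.
Variables (R : realType) (Y T : topologicalType) (L : groupoid T).
Variables (V : set T) (sg : T -> T) (tau : Y -> T).
Hypotheses (hY : hausdorff_space Y) (sec : local_section L V sg).
Hypotheses (ctau : continuous tau) (tauU : forall y, gunits L (tau y)).

(** The tool behind both the products and the tensor decomposition: a function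
    [F y x] on the fibered product over the unit space, compactly supported
    where [x] is in [V], becomes a function of [y] alone by substituting for [x]
    the only point of [V] in the fiber of [tau y].  Around a point of the
    projection of the support the result is [F] composed with the section; away
    from that compact set it vanishes. *)
Lemma Cc_along_section (F : Y * T -> R[i]) (C : set (Y * T)) :
  compact C ->
  (forall p, C p -> tau p.1 = grange L p.2 /\ V p.2) ->
  (forall p, C p ->
    (F : Y * T -> R[i]^o) @ within [set p | tau p.1 = grange L p.2] (nbhs p)
      --> (F p : R[i]^o)) ->
  (forall p, tau p.1 = grange L p.2 -> V p.2 -> ~ C p -> F p = 0) ->
  exists f : Y -> R[i], [/\ Cc R Y f,
    forall p, tau p.1 = grange L p.2 -> V p.2 -> f p.1 = F p &
    forall y, (forall x, V x -> tau y <> grange L x) -> f y = 0].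
Proof.
move=> cC CP cF F0.
pose ok y := V (sg (tau y)) /\ grange L (sg (tau y)) = tau y.
pose f y := if `[< ok y >] then F (y, sg (tau y)) else 0.
have fE p : tau p.1 = grange L p.2 -> V p.2 -> f p.1 = F p.
  case: p => y x /= e Vx; have [sx _ _] := sec Vx.
  by rewrite /f asboolT /ok e sx.
have f0 y : ~ (fst @` C) y -> f y = 0.
  rewrite /f; case: asboolP => // -[Vs rs] ny; apply: F0 => //= Cy; apply: ny.
  by exists (y, sg (tau y)).
have cfC : compact (fst @` C).
  apply: continuous_compact => //; apply: continuous_subspaceT => p.
  exact: cvg_fst.
exists f; split=> //; last first.
  move=> y ny; rewrite /f asboolF// => -[Vs rs].
  exact: (ny _ Vs).
apply: (Cc_sub hY _ cfC f0); apply: (continuous_compact_support _ f0).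
  exact: compact_closed.
move=> _ [[y x] Cp <-] /=; have [e Vx] := CP _ Cp.
have [/= sx nok csg] := sec Vx.
have ctauw : tau @ y --> within (gunits L) (nbhs (grange L x)).
  by rewrite -(e : tau y = grange L x); exact: (cvg_into_within (@ctau y) tauU).
have nok' : nbhs y [set t | ok t] := ctauw _ nok.
have fyx : f y = F (y, x) by exact: (fE (y, x)).
rewrite /prop_for /continuous_at fyx.
have : (fun t => F (t, sg (tau t)) : R[i]^o) @ y --> (F (y, x) : R[i]^o).
  apply: cvg_trans (cF _ Cp) => N nN.
  have cp : (fun t => (t, sg (tau t))) @ y --> ((y, x) : Y * T).
    apply: cvg_pair; first exact: cvg_id.
    exact: (cvg_comp _ _ ctauw csg).
  have cn : nbhs y [set t | tau t = grange L (sg (tau t)) ->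
    N (F (t, sg (tau t)))] := cp _ nN.
  change (nbhs y [set t | N (F (t, sg (tau t)))]).
  by apply: filterS2 nok' cn => t [_ et]; apply.
apply: cvg_trans; apply: near_eq_cvg; apply: filterS nok' => t okt.
by rewrite /f asboolT.
Qed.

End FiberSum.

(** * Bump functions supported where the range map has a section *)

Section Bumps.
Local Open Scope complex_scope.
Variables (R : realType).

(** Complete regularity separates [x] from the complement of a neighborhood
    with compact closure inside [W]; one minus the separating function is a
    bump. *)
Lemma exists_bump (T : topologicalType) (x : T) (W : set T) :
  hausdorff_space T -> locally_compact [set: T] -> nbhs x W ->
  exists e : T -> R[i], [/\ Cc R T e, e x != 0 & supp e `<=` W].
Proof.
move=> hT lT nW; have [N + [cN _]] := lT x I.
rewrite withinET => nN.
have [M nM MW] : filter_from (nbhs x) closure (N `&` W).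
  by apply: (compact_regular hT cN nN); exact: filterI.
have sep : uniform_separator [set x] (~` M°).
  apply: (@locally_compact_completely_regular T R lT hT).
    by apply: open_closedC; exact: open_interior.
  by move=> /(_ nM).
have [f [cf _ fx f1]] := (uniform_separatorP (R := R) _ _).1 sep.
pose e y : R[i] := (1 - f y)%:C.
have e0 y : ~ closure M y -> e y = 0.
  move=> ny; have -> : e y = (1 - 1)%:C; last by rewrite subrr.
  rewrite /e; congr (1 - _)%:C; apply: f1; exists y => //= My; apply: ny.
  by apply: subset_closure; exact: interior_subset.
have se : supp e `<=` closure M by apply: sub_supp => //; exact: closed_closure.
exists e; split.
- apply: (@Cc_sub _ _ _ N) => // [x0|y Ny]; last first.
    by apply: e0 => /MW[].
  apply/continuous_at_dist => d d0.
  have d0' : 0 < complex.Re d by rewrite ltcE in d0; case/andP: d0.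
  have -> : d = (complex.Re d)%:C by rewrite RRe_real// gtr0_real.
  have := cf x0; move=> /cvgrPdist_lt/(_ _ d0').
  apply: filterS => t; have -> : e x0 - e t = (f t - f x0)%:C.
    apply/eqP; rewrite eq_complex /= opprB [_ + (f t - 1)]addrC subrKA subr0.
    by rewrite !eqxx.
  by rewrite normc_def /= expr0n addr0 sqrtr_sqr ltcR distrC.
- have -> : e x = 1 by rewrite /e (fx (f x)) ?subr0//; exists x.
  exact: oner_neq0.
- by move=> y /se /MW[].
Qed.

Variables (T : topologicalType) (L : groupoid T).

Definition section_bump (e : T -> R[i]) : Prop :=
  exists V sg, [/\ local_section L V sg, Cc R T e & supp e `<=` V].

Definition has_section_bumps : Prop :=
  forall x, exists2 e, section_bump e & e x != 0.

(** A product of each bump with its conjugate, rather than the bump itself, so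
    that one factor can serve as a cutoff in each of two variables. *)
Definition sumsq (es : seq (T -> R[i])) (x : T) : R[i] :=
  \sum_(e <- es) e x * conjc (e x).

Lemma sumsq_neq0 es e x : e \in es -> e x != 0 -> sumsq es x != 0.
Proof.
move=> ees ex; rewrite /sumsq; under eq_bigr do rewrite -sqr_normc.
apply/eqP => /eqP; rewrite psumr_eq0; last by move=> *; exact: exprn_ge0.
by move=> /allP/(_ _ ees); rewrite /= sqrf_eq0 normr_eq0 (negbTE ex).
Qed.

Lemma continuous_sumsq es :
  (forall e, e \in es -> continuous (e : T -> R[i]^o)) ->
  continuous (sumsq es : T -> R[i]^o).
Proof.
elim: es => [|e es IH] ces x.
  rewrite /sumsq; under eq_fun do rewrite big_nil; exact: cvg_cst.
rewrite /sumsq; under eq_fun do rewrite big_cons.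
apply: continuousD_at; last first.
  by apply: IH => f fes; apply: ces; rewrite inE fes orbT.
have ce : {for x, continuous (e : T -> R[i]^o)}.
  by apply: ces; rewrite inE eqxx.
apply: (@continuousM_at _ _ e (fun x => conjc (e x))); first exact: ce.
by apply: (continuous_comp ce); exact: continuous_conjc.
Qed.

(** Compactness enters as a statement about filters: the relevant filter is that
    of finite families of bumps, directed by inclusion. *)
Lemma finite_section_bumps (Q : set T) : has_section_bumps -> compact Q ->
  exists es, (forall e, e \in es -> section_bump e) /\
    forall x, Q x -> sumsq es x != 0.
Proof.
move=> hb /compact_near_coveringP cQ.
pose good (s : seq (T -> R[i])) := forall e, e \in s -> section_bump e.
pose F := filter_from good (fun s => [set s' | good s' /\ {subset s <= s'}]).
have FF : ProperFilter F.
  apply: filter_from_proper; last by move=> s gs; exists s; split.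
  apply: filter_from_filter; first by exists [::].
  move=> s s' gs gs'; exists (s ++ s').
    by move=> e; rewrite mem_cat => /orP[/gs|/gs'].
  move=> u [gu su]; split; split=> // e es; apply: su; rewrite mem_cat es//.
  by rewrite orbT.
have FQ : F (good `&` [set es | Q `<=` (fun x => sumsq es x != 0)]).
  apply: filterI; first by exists [::] => // s [].
  apply: (cQ _ F (fun es x => sumsq es x != 0)) => x _; have [e be ex] := hb x.
  exists ([set y | e y != 0], [set s | good s /\ e \in s]) => /=; last first.
    by move=> [y s] /= [ey [_ es]]; exact: sumsq_neq0 ey.
  split; last first.
    exists [:: e] => [f|s [gs /(_ e)]]; first by rewrite inE => /eqP ->.
    by rewrite inE eqxx => /(_ isT).
  have [V [sg [_ [ce _] _]]] := be.
  have /continuous_at_dist := ce x; move=> /(_ `|e x|).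
  rewrite normr_gt0 => /(_ ex); apply: filterS => y.
  by apply: contraTN => /eqP ->; rewrite subr0 ltxx.
by have [es] := filter_ex FQ; exists es.
Qed.

End Bumps.

Section EmbeddingBumps.
Variables (R : realType) (T' T : topologicalType).
Variables (L : groupoid T') (K : groupoid T) (iota : T' -> T) (pr : T -> T').
Hypothesis E : wide_open_embedding L K iota pr.
Hypotheses (hT : hausdorff_space T) (lT : locally_compact [set: T]).
Hypothesis lh : local_homeomorphism (range_map K).

Lemma emb_gunits u : gunits L u -> gunits K (iota u).
Proof. by move=> [x _ <-]; exists (iota x) => //; rewrite (emb_grange E). Qed.

(** The section of the range map of [K], started at the image of a unit of [L],
    stays in the range of [iota] for a while because that range is open. *)
Lemma emb_local_section V sg :
  local_section K V sg -> local_section L (iota @^-1` V) (pr \o sg \o iota).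
Proof.
move=> sec x Vx; have [s1 s2 s3] := sec _ Vx.
have ci : iota @ within (gunits L) (nbhs (grange L x)) -->
          within (gunits K) (nbhs (grange K (iota x))).
  rewrite -(emb_grange E); apply: cvg_within_map; first exact: (emb_cont E).
  exact: emb_gunits.
split.
- by rewrite /= (emb_grange E) s1 (embK E).
- have s4 := s3 _ (open_nbhs_nbhs (conj (emb_open E) (imageT iota x))).
  have : within (gunits L) (nbhs (grange L x)) [set u |
      (V (sg (iota u)) /\ grange K (sg (iota u)) = iota u) /\
      range iota (sg (iota u))].
    exact: (ci _ (filterI s2 s4)).
  rewrite /within /=; apply: filterS => u + Lu => /(_ Lu)[[Vs rs]].
  move=> /(emb_range E) es /=; rewrite es; split=> //.
  by apply: (emb_inj E); rewrite (emb_grange E) es.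
- have c1 := cvg_comp _ _ ci s3.
  have c2 : pr @ nbhs (iota x) --> x.
    by rewrite -[X in _ --> X](embK E); exact: (pr_cont E).
  exact: (cvg_comp _ _ c1 c2).
Qed.

Lemma emb_section_bumps : has_section_bumps R L.
Proof.
move=> x; have [V [sg [oV Vx sec]]] := etale_local_section lh (iota x).
have nW : nbhs (iota x) V by apply: open_nbhs_nbhs; split.
have [e [[ce se] ex sV]] := exists_bump R hT lT nW.
have cei : continuous (e \o iota : T' -> R[i]^o).
  by move=> y; apply: continuous_comp; [exact: (emb_cont E)|exact: ce].
have cV : closed (iota @^-1` supp e).
  apply: preimage_closed; last exact: supp_closed.
  by move=> y _; exact: (emb_cont E).
have sV' : supp (e \o iota) `<=` iota @^-1` supp e.
  by apply: sub_supp => // y /supp_out.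
exists (e \o iota) => //; exists (iota @^-1` V), (pr \o sg \o iota); split.
- exact: emb_local_section.
- apply: (Cc_sub (emb_hausdorff E hT) cei (emb_preimage_compact E hT se)).
  by move=> y /supp_out.
- by apply: subset_trans sV' _ => y /sV.
Qed.

End EmbeddingBumps.

(** * Convolution *)

Section Convolution.
Variables (R : realType) (T : topologicalType) (L : groupoid T).
Hypotheses (hT : hausdorff_space T) (tL : topological_groupoid L).

(** Multiply by the quadratic partition of unity given by bumps around the
    support. *)
Lemma section_bump_split (xi : T -> R[i]) :
  has_section_bumps R L -> Cc R T xi ->
  exists2 xs, (forall x, x \in xs -> section_bump L x) &
    xi = fun t => \sum_(x <- xs) x t.
Proof.
move=> hb [cxi sxi]; have [es [be es0]] := finite_section_bumps hb sxi.
have ces e : e \in es -> continuous (e : T -> R[i]^o).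
  by move=> /be[V [sg [_ []]]].
pose part e : T -> R[i] :=
  fun t => xi t * ((e t * conjc (e t)) * (sumsq es t)^-1).
exists [seq part e | e <- es]; last first.
  apply/funext => t; rewrite big_map /part -mulr_sumr -mulr_suml -/(sumsq es t).
  have [/es0 s0|/supp_out ->] := pselect (supp xi t); last by rewrite mul0r.
  by rewrite divff// mulr1.
move=> _ /mapP[e ees ->]; have [V [sg [sec [ce se] sV]]] := be _ ees.
have p0 t : ~ supp xi t -> part e t = 0.
  by move=> /supp_out h; rewrite /part h mul0r.
have cp : continuous (part e : T -> R[i]^o).
  apply: (@continuous_compact_support R T (part e) _ (@supp_closed R T xi) p0).
  move=> t Qt; apply: (@continuousM_at _ _ xi
    (fun t => (e t * conjc (e t)) * (sumsq es t)^-1)).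
    exact: cxi.
  apply: (@continuousM_at _ _ (fun t => e t * conjc (e t))
    (fun t => (sumsq es t)^-1)).
    apply: (@continuousM_at _ _ e (fun x => conjc (e x))); first exact: ce.
    by apply: (continuous_comp (ce t)); exact: continuous_conjc.
  apply: (@continuousV_at _ _ (sumsq es)); first exact: es0.
  exact: continuous_sumsq.
exists V, sg; split=> //; first exact: Cc_sub hT cp sxi p0.
apply: subset_trans sV; apply: sub_supp; first exact: supp_closed.
by move=> t /supp_out h; rewrite /part h !mul0r mulr0.
Qed.

(** The sum over the factorizations of [y] has at most one nonzero term, since
    the first factor must be the point of [V] with the same range as [y]; so
    the convolution is an instance of [Cc_along_section].  It is supported in
    the product of the two supports, a continuous image of a compact set of
    composable pairs. *)
Lemma Cc_convolution (xi eta : T -> R[i]) :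
  section_bump L xi -> Cc R T eta -> Cc R T (convolution L xi eta).
Proof.
move=> [V [sg [sec [cxi sxi] sV]]] [ceta seta].
have [cm ci] := tL; move/subspace_continuousP: cm => cm.
pose A := (supp xi `*` supp eta) `&` gcomp L.
pose C := (fun q => (gmul L q.1 q.2, q.1)) @` A.
have cA : compact A.
  apply: compact_closedI; first exact: compact_setX.
  exact: closed_gcomp.
have cC : compact C.
  apply: continuous_compact => //; apply/subspace_continuousP => q [_ cq].
  apply: cvg_pair; last first.
    apply: (@cvg_trans _ (fst @ nbhs q)); last exact: cvg_fst.
    by apply: cvg_app; exact: cvg_within.
  apply: cvg_trans (cm _ cq); apply: cvg_app; apply: within_subset.
  by move=> ? [].
pose F p := xi p.2 * eta (gmul L (ginv L p.2) p.1) : R[i].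
have Pc p : grange L p.1 = grange L p.2 -> gcomp L (ginv L p.2, p.1).
  by move=> e; apply: eq_gcomp; rewrite gsourceV.
have [|||f [cf fE f0]] := @Cc_along_section R _ _ _ _ _ (grange L) hT sec
    (continuous_grange tL) (@grange_unit _ L) F C cC.
- move=> _ [q [[sq _] cq] <-] /=; split.
    by rewrite grangeM//; case: q cq {sq}.
  exact: sV.
- move=> p [q [_ cq] qp]; have e : grange L p.1 = grange L p.2.
    by rewrite -qp grangeM//; case: q cq {qp}.
  apply: (@cvgM R[i]).
    have : {for p, continuous (xi \o snd : T * T -> R[i]^o)}.
      apply: (@continuous_comp _ _ _ snd (xi : T -> R[i]^o) p).
        exact: cvg_snd.
      exact: cxi.
    by apply: cvg_trans; apply: cvg_app; exact: cvg_within.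
  have c0 : {for p, continuous (fun q => (ginv L q.2, q.1))}.
    apply: cvg_pair; [|exact: cvg_fst].
    apply: (@continuous_comp _ _ _ snd (ginv L) p); first exact: cvg_snd.
    exact: ci.
  have c1 := cvg_comp _ _ (cvg_within_map c0 Pc) (cm _ (Pc p e)).
  exact: (cvg_comp _ _ c1 (ceta _)).
- move=> p e Vp nC; apply/eqP; rewrite /F mulf_eq0 -[_ || _]negbK negb_or.
  apply/negP => /andP[x0 e0]; apply: nC.
  exists (p.2, gmul L (ginv L p.2) p.1) => /=.
    split; last exact: (gcompA (gcompgV L p.2) (Pc p e)).2.
    by split; apply: subset_closure.
  have := gmulKg (Pc p e); rewrite ginvK => ->.
  by rewrite -surjective_pairing.
suff -> : convolution L xi eta = f by [].
have Vsupp x : xi x != 0 -> V x by move=> x0; apply: sV; exact: subset_closure.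
apply/funext => y; rewrite /convolution.
have [[x [Vx yx]]|nx] := pselect (exists x, V x /\ grange L y = grange L x).
  have cx : gcomp L (ginv L x, y) := Pc (y, x) yx.
  rewrite (fE (y, x) yx Vx) -(fsbig_widen [set (x, gmul L (ginv L x) y)]).
  - by rewrite fsbig_set1.
  - move=> _ -> /=; split; first exact: (gcompA (gcompgV L x) cx).2.
    by have := gmulKg cx; rewrite ginvK.
  - move=> [p1 p2] [/= [c e] ne]; have [->|x0] := eqVneq (xi p1) 0.
      by rewrite mul0r.
    case: ne; have p1x : p1 = x.
      have [<- _ _] := sec _ (Vsupp _ x0); have [<- _ _] := sec _ Vx.
      by rewrite -yx -e grangeM.
    by rewrite -p1x -e gmulKg.
rewrite f0; last by move=> x Vx e; apply: nx; exists x.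
rewrite fsbig1// => -[p1 p2] /= [c e]; have [->|x0] := eqVneq (xi p1) 0.
  by rewrite mul0r.
by case: nx; exists p1; split; [exact: Vsupp|rewrite -e grangeM].
Qed.

End Convolution.

(** * The homomorphism induced by a wide open subgroupoid *)

Section CstarExtension.
Variables (R : realType).

Lemma rnormE (V : normedModType R[i]) (x : V) : `|x| = (rnorm x)%:C%C.
Proof. by rewrite RRe_real// normr_real. Qed.

Lemma Cc_involution (T : topologicalType) (L : groupoid T) (xi : T -> R[i]) :
  hausdorff_space T -> topological_groupoid L ->
  Cc R T xi -> Cc R T (involution L xi).
Proof.
move=> hT [_ ci] [cx sx]; apply: (@Cc_sub R T _ (ginv L @` supp xi) hT).
- move=> x; apply: (@continuous_comp _ _ _ (fun g => xi (ginv L g) : R[i]^o)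
      (fun z => conjc z : R[i]^o)); last exact: continuous_conjc.
  apply: (@continuous_comp _ _ _ (ginv L) (xi : T -> R[i]^o)); first exact: ci.
  exact: cx.
- by apply: continuous_compact sx; exact: continuous_subspaceT.
- move=> x nx; rewrite /involution (@supp_out _ _ xi) ?rmorph0// => sV.
  by apply: nx; exists (ginv L x) => //; rewrite ginvK.
Qed.

Section CcIn.
Variables (T : topologicalType) (L : groupoid T) (CL : groupoid_cstar R L).

Lemma Cc_in0 : Cc_in CL (fun=> 0) = 0.
Proof.
have := Cc_in_linear CL (-1) (Cc0 R T) (Cc0 R T).
rewrite scaleN1r addNr => <-; congr Cc_in.
by apply/funext => x; rewrite mulr0 addr0.
Qed.

Lemma Cc_inD xi eta : Cc R T xi -> Cc R T eta ->
  Cc_in CL (fun t => xi t + eta t) = Cc_in CL xi + Cc_in CL eta.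
Proof.
move=> cx ce; have := Cc_in_linear CL 1 cx ce; rewrite scale1r => <-.
by congr Cc_in; apply/funext => x; rewrite mul1r.
Qed.

Lemma Cc_in_sum (I : eqType) (s : seq I) (F : I -> T -> R[i]) :
  (forall i, i \in s -> Cc R T (F i)) ->
  Cc R T (fun t => \sum_(i <- s) F i t) /\
  Cc_in CL (fun t => \sum_(i <- s) F i t) = \sum_(i <- s) Cc_in CL (F i).
Proof.
elim: s => [|i s IH] cF.
  under eq_fun do rewrite big_nil; rewrite big_nil.
  by split; [exact: Cc0|exact: Cc_in0].
have [cs es] : Cc R T (fun t => \sum_(i <- s) F i t) /\
  Cc_in CL (fun t => \sum_(i <- s) F i t) = \sum_(i <- s) Cc_in CL (F i).
  by apply: IH => j js; apply: cF; rewrite inE js orbT.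
under eq_fun do rewrite big_cons; rewrite big_cons.
have ci : Cc R T (F i) by apply: cF; rewrite inE eqxx.
by split; [exact: CcD|rewrite Cc_inD// es].
Qed.

End CcIn.

Variables (T' T : topologicalType) (L : groupoid T') (K : groupoid T).
Variables (iota : T' -> T) (pr : T -> T').
Hypothesis E : wide_open_embedding L K iota pr.
Hypotheses (hT : hausdorff_space T) (tL : topological_groupoid L).
Hypothesis bL : has_section_bumps R L.
Variables (CL : groupoid_cstar R L) (CK : groupoid_cstar R K).

(** The graph is that of extension by zero.  Products of its points are in it
    because the first factor can be taken supported where the range map has a
    section, after which the convolution is in C_c. *)
Lemma cstar_extend0 : exists h : CL -> CK, star_homomorphism h /\
  forall xi, Cc R T' xi -> h (Cc_in CL xi) = Cc_in CK (extend0 iota pr xi).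
Proof.
have hT' := emb_hausdorff E hT.
pose G := [set (Cc_in CL xi, Cc_in CK (extend0 iota pr xi)) | xi in Cc R T'].
have cE xi : Cc R T' xi -> Cc R T (extend0 iota pr xi).
  exact: (Cc_extend0 E hT).
have G0 : G (0, 0).
  exists (fun=> 0); first exact: Cc0.
  rewrite Cc_in0; congr pair; rewrite -(Cc_in0 CK); congr Cc_in.
  by apply/funext => x; rewrite /extend0 mulr0.
have linG (c : R[i]) p q : G p -> G q -> G (c *: p.1 + q.1, c *: p.2 + q.2).
  move=> [xi cx <-] [eta ce <-]; exists (fun t => c * xi t + eta t).
    exact: Cc_linear.
  by rewrite /= extend0_linear !Cc_in_linear//; exact: cE.
have [|||||h [hs hG]] := @star_homomorphism_extension R CL CK G.
- move=> O [x Ox] oO; have [y [Oy [xi cx e]]] :=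
    @Cc_in_dense _ _ _ CL O (ex_intro _ x Ox) oO.
  exists y; split=> //.
  by exists (Cc_in CL xi, Cc_in CK (extend0 iota pr xi)) => //; exists xi.
- move=> _ [xi cx <-] /=; rewrite !rnormE lecR -lee_fin !Cc_in_norm//.
    exact: full_norm_extend0.
  exact: cE.
- exact: linG.
- move=> _ _ [xi cx <-] [eta ce <-] /=.
  have [xs bx ->] := section_bump_split hT' bL cx.
  have cxs x : x \in xs -> Cc R T' x.
    by move=> /bx[V [sg []]].
  have -> : extend0 iota pr (fun t => \sum_(x <- xs) x t) =
            fun z => \sum_(x <- xs) extend0 iota pr x z.
    by apply/funext => z; rewrite /extend0 mulr_sumr.
  have [_ ->] := Cc_in_sum CL cxs.
  have [_ ->] := Cc_in_sum CK (fun x xs => cE _ (cxs x xs)).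
  elim: xs bx {cxs} => [|x xs IH] bx.
    by rewrite !big_nil !smul0l.
  rewrite !big_cons !smulDl.
  have bxx : section_bump L x by apply: bx; rewrite inE eqxx.
  have [V [sg [_ cxx _]]] := bxx.
  have Gx : G (smul (Cc_in CL x) (Cc_in CL eta),
      smul (Cc_in CK (extend0 iota pr x)) (Cc_in CK (extend0 iota pr eta))).
    exists (convolution L x eta); first exact: Cc_convolution.
    by rewrite -(extend0_convolution E) !Cc_in_convolution//; exact: cE.
  have := linG 1 _ _ Gx (IH _); rewrite /= !scale1r; apply.
  by move=> y yxs; apply: bx; rewrite inE yxs orbT.
- move=> _ [xi cx <-] /=; exists (involution L xi); first exact: Cc_involution.
  by rewrite (extend0_involution E) !Cc_in_involution//; exact: cE.
exists h; split=> // xi cx.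
rewrite -[RHS]/(Cc_in CL xi, Cc_in CK (extend0 iota pr xi)).2 -hG//.
by exists xi.
Qed.

End CstarExtension.

(** * The Zappa-Szep product *)

Section ZappaSzepEmbeddings.
Variables (S T U : topologicalType) (G : groupoid S) (H : groupoid T).
Variables (eG : unit_identification G U) (eH : unit_identification H U).
Variable Z : zappa_szep eG eH.
Hypotheses (topG : topological_groupoid G) (topH : topological_groupoid H).
Hypotheses (homG : unit_homeomorphism eG) (homH : unit_homeomorphism eH).
Hypothesis etaleZ : lch_etale_groupoid (zs_groupoid Z).

Local Notation K := (zs_groupoid Z).
Local Notation zsT := (zs_type eG eH).

Lemma zsG_proof g : (g, unit_of eH (src eG g)) \in zs_set eG eH.
Proof. by rewrite inE /zs_set /= rng_unit. Qed.

Lemma zsH_proof h : (unit_of eG (rng eH h), h) \in zs_set eG eH.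
Proof. by rewrite inE /zs_set /= src_unit. Qed.

Definition zsG (g : S) : zsT := SigSub (zsG_proof g).
Definition zsH (h : T) : zsT := SigSub (zsH_proof h).
Definition zsprG (z : zsT) : S := (val z).1.
Definition zsprH (z : zsT) : T := (val z).2.

Lemma continuous_zs (X : topologicalType) (f : X -> zsT) :
  continuous (zsprG \o f) -> continuous (zsprH \o f) -> continuous f.
Proof.
move=> c1 c2; apply: continuous_comp_initial => x.
have -> : set_val \o f = fun x => (zsprG (f x), zsprH (f x)).
  by apply/funext => y; rewrite /zsprG /zsprH /= -surjective_pairing.
by apply: cvg_pair; [exact: c1|exact: c2].
Qed.

Lemma continuous_zsval : continuous (val : zsT -> S * T).
Proof. exact: initial_continuous. Qed.

Lemma continuous_zsprG : continuous zsprG.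
Proof.
move=> z; apply: (@continuous_comp _ _ _ (val : zsT -> S * T) fst).
  exact: continuous_zsval.
exact: cvg_fst.
Qed.

Lemma continuous_zsprH : continuous zsprH.
Proof.
move=> z; apply: (@continuous_comp _ _ _ (val : zsT -> S * T) snd).
  exact: continuous_zsval.
exact: cvg_snd.
Qed.

Lemma continuous_zsG : continuous zsG.
Proof.
apply: continuous_zs => g; first exact: cvg_id.
apply: (@continuous_comp _ _ _ (src eG) (unit_of eH)).
  exact: continuous_src.
exact: homH.1.
Qed.

Lemma continuous_zsH : continuous zsH.
Proof.
apply: continuous_zs => g; last exact: cvg_id.
apply: (@continuous_comp _ _ _ (rng eH) (unit_of eG)).
  exact: continuous_rng.
exact: homG.1.
Qed.

Lemma zs_grangeE z : grange K z = zs_unit eG eH (rng eG (val z).1).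
Proof. exact: (zs_mulgV Z z). Qed.

Lemma zs_gunitsP z : gunits K z <-> exists u, z = zs_unit eG eH u.
Proof.
split=> [[w _ <-]|[u ->]].
  by exists (rng eG (val w).1); exact: zs_grangeE.
by exists (zs_unit eG eH u) => //; rewrite zs_grangeE zs_unitE rng_unit.
Qed.

Lemma zs_eq (z w : zsT) : zsprG z = zsprG w -> zsprH z = zsprH w -> z = w.
Proof.
move=> e1 e2; apply: val_inj.
by rewrite [LHS]surjective_pairing [RHS]surjective_pairing; congr pair.
Qed.

Lemma zsG_mul g1 g2 : gcomp G (g1, g2) ->
  zsG (gmul G g1 g2) = zs_mul Z (zsG g1) (zsG g2).
Proof.
move=> /(gcompP eG) c; apply: val_inj; rewrite zs_mulE; last first.
  by rewrite /zs_comp /= src_unit.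
by rewrite /zs_mul_raw /= c ZS8 zres_unit unitM srcM.
Qed.

Lemma zsH_mul h1 h2 : gcomp H (h1, h2) ->
  zsH (gmul H h1 h2) = zs_mul Z (zsH h1) (zsH h2).
Proof.
move=> /(gcompP eH) c; apply: val_inj; rewrite zs_mulE; last first.
  by rewrite /zs_comp /= rng_unit.
by rewrite /zs_mul_raw /= -c zact_unit ZS9 unitM rngM.
Qed.

(** The factorization of an element of the product into its two components. *)
Lemma zs_factor z : zs_mul Z (zsG (zsprG z)) (zsH (zsprH z)) = z.
Proof.
have e := zs_typeP z; apply: val_inj; rewrite zs_mulE; last first.
  by rewrite /zs_comp /= rng_unit src_unit.
rewrite /zs_mul_raw /= /zsprG /zsprH e.
have := ZS8 Z (unit_of eG (rng eH (val z).2)); rewrite rng_unit => ->.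
have := zres_unit Z (unit_of eG (rng eH (val z).2)).
rewrite rng_unit src_unit => ->.
by rewrite mul_rng -e mul_src -surjective_pairing.
Qed.

(** This characterization makes the range of [zsG] open, as the preimage of the
    open set of units under a continuous map. *)
Lemma zsG_rangeP z : range zsG z <-> gunits K (zsH (zsprH z)).
Proof.
have e := zs_typeP z; split=> [[g _ <-]|/zs_gunitsP[u /(congr1 val)[_ h]]].
  apply/zs_gunitsP; exists (src eG g); apply: zs_eq => //=.
  by rewrite /zsprG /= rng_unit.
exists (zsprG z) => //; apply: zs_eq => //.
by rewrite /zsprH /zsprG /= e -/(zsprH z) h rng_unit.
Qed.

Lemma zsH_rangeP z : range zsH z <-> gunits K (zsG (zsprG z)).
Proof.
have e := zs_typeP z; split=> [[h _ <-]|/zs_gunitsP[u /(congr1 val)[g _]]].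
  apply/zs_gunitsP; exists (rng eH h); apply: zs_eq => //=.
  by rewrite /zsprH /= src_unit.
exists (zsprH z) => //; apply: zs_eq => //.
by rewrite /zsprH /zsprG /= -e -/(zsprG z) g src_unit.
Qed.

Let openU : open (gunits K).
Proof. by have [? _ _ ?] := etaleZ; exact: open_gunits. Qed.

Lemma zsG_embedding : wide_open_embedding G K zsG zsprG.
Proof.
split.
- exact: continuous_zsG.
- exact: continuous_zsprG.
- by [].
- by move=> x y; rewrite /= /zs_comp /= src_unit; split=> /(gcompP eG).
- exact: zsG_mul.
- move=> _ /zs_gunitsP[u ->]; exists (unit_of eG u) => //.
  by apply: zs_eq => //; rewrite /zsprH /= src_unit.
- have -> : range zsG = (zsH \o zsprH) @^-1` gunits K.
    by apply/seteqP; split=> z /zsG_rangeP.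
  apply: open_comp => // z _; apply: continuous_comp.
    exact: continuous_zsprH.
  exact: continuous_zsH.
Qed.

Lemma zsH_embedding : wide_open_embedding H K zsH zsprH.
Proof.
split.
- exact: continuous_zsH.
- exact: continuous_zsprH.
- by [].
- by move=> x y; rewrite /= /zs_comp /= rng_unit; split=> /(gcompP eH).
- exact: zsH_mul.
- move=> _ /zs_gunitsP[u ->]; exists (unit_of eH u) => //.
  by apply: zs_eq => //; rewrite /zsprG /= rng_unit.
- have -> : range zsH = (zsG \o zsprG) @^-1` gunits K.
    by apply/seteqP; split=> z /zsH_rangeP.
  apply: open_comp => // z _; apply: continuous_comp.
    exact: continuous_zsprG.
  exact: continuous_zsG.
Qed.

Variable R : realType.

Lemma zs_iE (xi : S -> R[i]) : zs_i xi = extend0 zsG zsprG xi :> (zsT -> R[i]).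
Proof.
apply/funext => z; rewrite /zs_i /extend0; congr (_%:R * _).
rewrite -val_eqE /= -pair_eqE /= [_ == (val z).1]eqxx eq_sym.
by rewrite /zsprG.
Qed.

Lemma zs_jE (eta : T -> R[i]) :
  zs_j eta = extend0 zsH zsprH eta :> (zsT -> R[i]).
Proof.
apply/funext => z; rewrite /zs_j /extend0; congr (_%:R * _).
rewrite -val_eqE /= -pair_eqE /= [_ == (val z).2]eqxx andbT eq_sym.
by rewrite /zsprH.
Qed.

(** Uniqueness of the factorization leaves a single term in the sum. *)
Lemma convolution_zs_i_zs_j (xi : S -> R[i]) (eta : T -> R[i]) :
  convolution K (zs_i xi) (zs_j eta) =
  fun z : zsT => xi (zsprG z) * eta (zsprH z).
Proof.
apply/funext => z; rewrite /convolution zs_iE zs_jE.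
rewrite -(fsbig_widen [set (zsG (zsprG z), zsH (zsprH z))]).
- rewrite fsbig_set1 /=.
  by rewrite (extend0_emb zsG_embedding) (extend0_emb zsH_embedding).
- move=> _ -> /=; split; last exact: zs_factor.
  by rewrite /zs_comp /= src_unit rng_unit; exact: zs_typeP.
move=> [p q] [/= [c e] ne].
have [[g _ ge]|ng] := pselect (range zsG p); last first.
  by rewrite /= (extend0_out zsG_embedding) ?mul0r.
have [[h _ he]|nh] := pselect (range zsH q); last first.
  by rewrite /= (extend0_out zsH_embedding) ?mulr0.
have gh : (g, h) \in zs_set eG eH.
  move: c; rewrite inE /zs_set /zs_comp /= -ge -he /=.
  by rewrite src_unit rng_unit.
have zw : z = SigSub gh by rewrite -e -ge -he -[RHS]zs_factor.
by case: ne; rewrite -ge -he zw.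
Qed.

Let hK : hausdorff_space zsT. Proof. by have [] := etaleZ. Qed.
Let hS : hausdorff_space S. Proof. exact: emb_hausdorff zsG_embedding hK. Qed.

(** Extension by zero from the product groupoid to all of [S * T], where slices
    can be taken freely. *)
Definition zs_ext (zeta : zsT -> R[i]) (p : S * T) : R[i] :=
  oapp zeta 0 (insub p).

Lemma zs_ext_val zeta z : zs_ext zeta (val z) = zeta z.
Proof. by rewrite /zs_ext valK. Qed.

Lemma continuous_zs_ext (zeta : zsT -> R[i]) z :
  continuous (zeta : zsT -> R[i]^o) ->
  (zs_ext zeta : S * T -> R[i]^o) @ within (zs_set eG eH) (nbhs (val z))
    --> (zeta z : R[i]^o).
Proof.
move=> cz N /cz /nbhs_set_type nN.
change (nbhs (val z) [set p | zs_set eG eH p -> N (zs_ext zeta p)]).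
rewrite /within /= in nN; apply: filterS nN => p h pK.
pose b : zsT := SigSub (mem_set pK).
have Nb := h pK b erefl; change (N (zs_ext zeta (val b))).
by rewrite zs_ext_val.
Qed.

(** On the support of [e] the second coordinate of a point of the product is
    determined by the first, through the local section of the range map of [H]:
    this is [Cc_along_section] over [tau = t], for which the fibered product is
    the Zappa-Szep product itself.  The factor [w] is meant to be the
    reciprocal of a sum of squares, which is continuous only where that sum does
    not vanish. *)
Lemma tensor_factor_bump (zeta : zsT -> R[i]) (e : T -> R[i]) (w : T -> R[i]) :
  Cc R zsT zeta -> section_bump H e ->
  (forall z, supp zeta z -> {for zsprH z, continuous (w : T -> R[i]^o)}) ->
  exists2 xi, Cc R S xi & forall z,
    xi (zsprG z) * conjc (e (zsprH z)) =
    zeta z * (e (zsprH z) * conjc (e (zsprH z)) * w (zsprH z)).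
Proof.
move=> [cz sz] [V [sg [sec [ce se] sV]]] cw.
pose tau (g : S) : T := unit_of eH (src eG g).
have ctau : continuous tau.
  move=> g; apply: (@continuous_comp _ _ _ (src eG) (unit_of eH)).
    exact: continuous_src.
  exact: homH.1.
have tauP p : tau p.1 = grange H p.2 <-> zs_set eG eH p.
  rewrite /tau -(unit_rng eH); split=> [|->//].
  by move/(congr1 (base_of eH)); rewrite !unit_ofK.
pose F p := zs_ext zeta p * (e p.2 * w p.2).
pose C := (val : zsT -> S * T) @` (supp zeta `&` zsprH @^-1` supp e).
have cC : compact C.
  apply: continuous_compact; first exact/continuous_subspaceT/continuous_zsval.
  apply: compact_closedI => //; apply: preimage_closed; last exact: supp_closed.
  by move=> z _; exact: continuous_zsprH.
have [||||f [cf fE f0]] :=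
  @Cc_along_section R _ _ _ _ _ tau hS sec ctau _ F C cC.
- by move=> g; exact: unit_of_unit.
- by move=> _ [z [_ ez] <-]; split; [apply/tauP/zs_typeP|exact: sV].
- move=> _ [z [zz _] <-].
  have -> : [set p | tau p.1 = grange H p.2] = zs_set eG eH.
    by apply/seteqP; split=> p /tauP.
  rewrite /F zs_ext_val; apply: (@cvgM R[i]); first exact: continuous_zs_ext.
  have : {for (val z).2, continuous (fun t => e t * w t : R[i]^o)}.
    by apply: continuousM_at; [exact: ce|exact: cw].
  have cs : {for val z, continuous (snd : S * T -> T)} by exact: cvg_snd.
  move=> c; have := continuous_comp cs c.
  by apply: cvg_trans; apply: cvg_app; exact: cvg_within.
- move=> p /tauP pK Vp nC; have [z zp] : exists z : zsT, val z = p.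
    by exists (SigSub (mem_set pK)).
  rewrite /F -zp zs_ext_val.
  have [sz'|/supp_out ->] := pselect (supp zeta z); last by rewrite mul0r.
  have [se'|/supp_out ->] := pselect (supp e (val z).2); last first.
    by rewrite mul0r mulr0.
  by case: nC; exists z.
exists f => // z.
have [->|e0] := eqVneq (e (zsprH z)) 0.
  by rewrite rmorph0 !(mul0r, mulr0).
have Vz : V (zsprH z) by apply: sV; exact: subset_closure.
have -> : f (zsprG z) = F (val z) by apply: fE => //; apply/tauP/zs_typeP.
by rewrite /F zs_ext_val -mulrA [e _ * w _ * _]mulrAC.
Qed.

(** That each tensor is itself in C_c(K) allows the class of the sum to be
    computed term by term in the completion. *)
Lemma Cc_tensor_span (zeta : zsT -> R[i]) : Cc R zsT zeta ->
  has_section_bumps R H ->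
  exists2 ts : seq ((S -> R[i]) * (T -> R[i])),
    forall p, p \in ts -> [/\ Cc R S p.1, Cc R T p.2 &
      Cc R zsT (fun z => p.1 (zsprG z) * p.2 (zsprH z))] &
    zeta = fun z => \sum_(p <- ts) p.1 (zsprG z) * p.2 (zsprH z).
Proof.
move=> cz bH; have [cze sze] := cz.
have cQ : compact (zsprH @` supp zeta).
  by apply: continuous_compact sze; exact/continuous_subspaceT/continuous_zsprH.
have [es [be es0]] := finite_section_bumps bH cQ.
have ces e : e \in es -> continuous (e : T -> R[i]^o).
  by move=> /be[V [sg [_ []]]].
pose w t := (sumsq es t)^-1.
have cw z : supp zeta z -> {for zsprH z, continuous (w : T -> R[i]^o)}.
  move=> sz; apply: (@continuousV_at _ _ (sumsq es)).
    by apply: es0; exists z.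
  exact: continuous_sumsq.
pose good e (xi : S -> R[i]) := e \in es -> Cc R S xi /\ forall z,
    xi (zsprG z) * conjc (e (zsprH z)) =
    zeta z * (e (zsprH z) * conjc (e (zsprH z)) * w (zsprH z)).
have /choice[X gX] : forall e, exists xi, good e xi.
  move=> e; have [ees|] := boolP (e \in es); last first.
    by move=> /negP ne; exists (fun=> 0) => /ne.
  by have [xi cxi exi] := tensor_factor_bump cz (be _ ees) cw; exists xi.
exists [seq (X e, fun t => conjc (e t)) | e <- es].
  move=> _ /mapP[e ees ->] /=; have [cX eX] := gX _ ees.
  have [V [sg [_ [ce se] _]]] := be _ ees.
  have cce : continuous (fun t => conjc (e t) : R[i]^o).
    by move=> t; apply: (continuous_comp (ce t)); exact: continuous_conjc.
  split; first exact: cX.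
    apply: (@Cc_sub R T _ (supp e) (emb_hausdorff zsH_embedding hK) cce se).
    by move=> t /supp_out ->; rewrite rmorph0.
  apply: (@Cc_sub R zsT _ (supp zeta) hK _ sze) => [z|z /supp_out z0];
    last by rewrite eX z0 mul0r.
  apply: (@continuousM_at _ _ (X e \o zsprG) ((fun t => conjc (e t)) \o zsprH)).
    apply: (@continuous_comp _ _ _ zsprG (X e : S -> R[i]^o)).
      exact: continuous_zsprG.
    exact: cX.1.
  apply: (@continuous_comp _ _ _ zsprH (fun t => conjc (e t) : R[i]^o)).
    exact: continuous_zsprH.
  exact: cce.
apply/funext => z; rewrite big_map /=.
under eq_big_seq => e ees do rewrite (gX _ ees).2.
rewrite -mulr_sumr -mulr_suml -/(sumsq es _).
have [sz|/supp_out ->] := pselect (supp zeta z); last by rewrite mul0r.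
by rewrite divff ?mulr1//; apply: es0; exists z.
Qed.

End ZappaSzepEmbeddings.

Theorem theorem4p2 (R : realType) (S T U : topologicalType)
  (G : groupoid S) (H : groupoid T)
  (eG : unit_identification G U) (eH : unit_identification H U)
  (Z : zappa_szep eG eH)
  (topG : topological_groupoid G) (topH : topological_groupoid H)
  (homG : unit_homeomorphism eG) (homH : unit_homeomorphism eH)
  (etaleZ : lch_etale_groupoid (zs_groupoid Z))
  (CG : groupoid_cstar R G) (CH : groupoid_cstar R H)
  (CZ : groupoid_cstar R (zs_groupoid Z)) :
  (forall xi, Cc R S xi -> Cc R (zs_type eG eH) (zs_i xi)) /\
  (forall eta, Cc R T eta -> Cc R (zs_type eG eH) (zs_j eta)) /\
  exists (i : CG -> CZ) (j : CH -> CZ),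
    [/\ star_homomorphism i,
        star_homomorphism j,
        forall xi, Cc R S xi -> i (Cc_in CG xi) = Cc_in CZ (zs_i xi),
        forall eta, Cc R T eta -> j (Cc_in CH eta) = Cc_in CZ (zs_j eta) &
        cstar_blend (fun a => mult_of (i a)) (fun b => mult_of (j b))].
Proof.
have [_ hK lK lh] := etaleZ.
have embG := zsG_embedding topG topH homG homH etaleZ.
have embH := zsH_embedding topG topH homG homH etaleZ.
have bG : has_section_bumps R G := emb_section_bumps R embG hK lK lh.
have bH : has_section_bumps R H := emb_section_bumps R embH hK lK lh.
have cI xi : Cc R S xi -> Cc R (zs_type eG eH) (zs_i xi).
  by rewrite zs_iE; exact: (Cc_extend0 embG hK).
have cJ eta : Cc R T eta -> Cc R (zs_type eG eH) (zs_j eta).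
  by rewrite zs_jE; exact: (Cc_extend0 embH hK).
split=> //; split=> //.
have [i [hi iE]] := cstar_extend0 embG hK topG bG CG CZ.
have [j [hj jE]] := cstar_extend0 embH hK topH bH CH CZ.
have iE' xi : Cc R S xi -> i (Cc_in CG xi) = Cc_in CZ (zs_i xi).
  by rewrite zs_iE; exact: iE.
have jE' eta : Cc R T eta -> j (Cc_in CH eta) = Cc_in CZ (zs_j eta).
  by rewrite zs_jE; exact: jE.
exists i, j; split=> //.
have [mlin mM _] := star_homomorphism_mult_of CZ.
have mult_sum t :
    blend_map (fun a => mult_of (i a)) (fun b => mult_of (j b)) t =
    mult_of (\sum_(p <- t) smul (i p.1) (j p.2)).
  rewrite /blend_map; elim: t => [|p t IH].
    rewrite !big_nil; have := mlin (-1) 0 0.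
    by rewrite !scaleN1r !addNr.
  rewrite !big_cons IH -mM -[smul (i p.1) _]scale1r mlin.
  by rewrite !scale1r.
split.
- exact: star_homomorphism_comp hi (star_homomorphism_mult_of CZ).
- exact: star_homomorphism_comp hj (star_homomorphism_mult_of CZ).
- by move=> t; exists (\sum_(p <- t) smul (i p.1) (j p.2)).
move=> O [x Ox] oO.
have [y [Oy [zeta cz e]]] := @Cc_in_dense _ _ _ CZ O (ex_intro _ x Ox) oO.
exists y; split=> //.
have [ts tsP zE] := Cc_tensor_span topG topH homG homH etaleZ cz bH.
exists [seq (Cc_in CG p.1, Cc_in CH p.2) | p <- ts].
rewrite mult_sum -e zE; congr mult_of.
have [|_ ->] := Cc_in_sum CZ (s := ts)
  (F := fun p z => p.1 (zsprG z) * p.2 (zsprH z)).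
  by move=> p /tsP[].
rewrite big_map; apply: eq_big_seq => p /tsP[c1 c2 _] /=.
rewrite iE'// jE'// -Cc_in_convolution; [|exact: cI|exact: cJ].
by rewrite (convolution_zs_i_zs_j topG topH homG homH etaleZ).
Qed.
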